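(* Let $f:\mathbb{R}^n\to\mathbb{R}$ and $x_0\in\mathbb{R}^n$. Suppose that the level set $\mathcal{L}_f(x_0)=\{x : f(x)\le f(x_0)\}$ is compact, and that $f$ is twice uniformly Lipschitz continuously differentiable on an open neighborhood of $\mathcal{L}_f(x_0)$ that includes the trial points generated by the Damped Newton-CG algorithm (described in the context) started at $x_0$, with $L_H$ a Lipschitz constant of $\nabla^2 f$ on this neighborhood. Let $f_{\mathrm{low}}$ be a lower bound of $f$ on $\mathcal{L}_f(x_0)$. Let $\epsilon_g>0$, $\epsilon_H\in(0,1)$, $\theta,\zeta\in(0,1)$, $\eta>0$ be the parameters of the algorithm. Suppose further that the Minimum Eigenvalue Oracle satisfies the following, for a specified failure probability $\delta$ with $0\le\delta\ll1$: for every iteration $k$ at which Damped Newton-CG calls the oracle, with probability $1-\delta$ the oracle either certifies that $\nabla^2f(x_k)\succeq-\epsilon_HI$ or finds a vector of curvature smaller than $-\epsilon_H/2$ in at most $N_{\mathrm{meo}}:=\min\{n,1+\lceil \mathcal{C}_{\mathrm{meo}}\epsilon_H^{-1/2}\rceil\}$ Hessian-vector products, where $\mathcal{C}_{\mathrm{meo}}$ depends at most logarithmically on $\delta$ and $\epsilon_H$. Define $$c_{sol} = \frac{\eta}{6}\min\left\{ \left[ \frac{4}{\sqrt{(4+\zeta)^2+8 L_H}+4+\zeta}\right]^3, \left[ \frac{3\theta^2 (1-\zeta) }{L_H+\eta}\right]^3\right\},\qquad c_{nc} = \frac{\eta}{6}\min\left\{1,\frac{27\theta^3}{(L_H+\eta)^3}\right\},$$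 $$\bar{K}_2 :=\left\lceil \frac{3(f(x_0)-f_{\mathrm{low}})}{\min\{c_{sol},c_{nc}/8\}}\max\{\epsilon_g^{-3}\epsilon_H^3, \epsilon_H^{-3}\} \right\rceil + 2 .$$ Then with probability at least $(1-\delta)^{\bar K_2}$, the Damped Newton-CG algorithm terminates, in at most $\bar K_2$ iterations, at a point $x$ satisfying $$\|\nabla f(x)\|\le\epsilon_g,\qquad \lambda_{\min}(\nabla^2f(x))\ge-\epsilon_H .$$ (With probability at most $1-(1-\delta)^{\bar K_2}$, it terminates incorrectly within $\bar K_2$ iterations at a point $x$ for which $\|\nabla f(x)\|\le\epsilon_g$ but $\lambda_{\min}(\nabla^2f(x))<-\epsilon_H$.)
   Context: $\|\cdot\|$ is the Euclidean norm (or induced matrix norm); $\lambda_{\min}$ is the smallest eigenvalue; $\mathrm{sgn}(0)=1$. Capped CG. Inputs: symmetric $H\in\mathbb{R}^{n\times n}$, $g\ne 0$, damping $\epsilon\in(0,1)$, accuracy $\zeta\in(0,1)$, optional scalar $M\ge 0$ (set to $0$ if not provided). Let $\bar H=H+2\epsilon I$. At any time, $\kappa=\frac{M+2\epsilon}{\epsilon}$, $\hat\zeta=\frac{\zeta}{3\kappa}$, $\tau=\frac{\sqrt\kappa}{\sqrt\kappa+1}$, $T=\frac{4\kappa^4}{(1-\sqrt\tau)^2}$ are computed from the current $M$. ''Update $M$ with $u$'' means: if $\|Hu\|>M\|u\|$, replace $M$ by $\|Hu\|/\|u\|$ and recompute $\kappa,\hat\zeta,\tau,T$. Start with $y_0=0$,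 $r_0=g$, $p_0=-g$, $j=0$. If $p_0^\top\bar Hp_0<\epsilon\|p_0\|^2$, return $d=p_0$ with d_type=NC; otherwise update $M$ with $p_0$. Then repeat: set $\alpha_j=r_j^\top r_j/p_j^\top\bar Hp_j$, $y_{j+1}=y_j+\alpha_jp_j$, $r_{j+1}=r_j+\alpha_j\bar Hp_j$, $\beta_{j+1}=r_{j+1}^\top r_{j+1}/r_j^\top r_j$, $p_{j+1}=-r_{j+1}+\beta_{j+1}p_j$; increase $j$ by $1$; update $M$ with $p_j$, then with $y_j$, then with $r_j$; then apply the tests in order: (1) if $y_j^\top\bar Hy_j<\epsilon\|y_j\|^2$, return $d=y_j$, d_type=NC; (2) else if $\|r_j\|\le\hat\zeta\|r_0\|$, return $d=y_j$, d_type=SOL; (3) else if $p_j^\top\bar Hp_j<\epsilon\|p_j\|^2$, return $d=p_j$, d_type=NC; (4) else if $\|r_j\|>\sqrt T\tau^{j/2}\|r_0\|$, compute $\alpha_j=r_j^\top r_j/p_j^\top\bar Hp_j$ and $y_{j+1}=y_j+\alpha_jp_j$, find $i\in\{0,\dots,j-1\}$ with $(y_{j+1}-y_i)^\top\bar H(y_{j+1}-y_i)<\epsilon\|y_{j+1}-y_i\|^2$, and return $d=y_{j+1}-y_i$, d_type=NC. Minimum Eigenvalue Oracle. Inputs: symmetric $H$, tolerance $\epsilon>0$, optional bound $M$ on $\|H\|$. Output: either $\lambda\le-\epsilon/2$ and a vector $v$ with $\|v\|=1$, $v^\top Hv=\lambda$; or a certificate that $\lambda_{\min}(H)\ge-\epsilon$,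 which is false with probability (at most) $\delta$. In the algorithm below, the failure probability at each call is understood conditionally on everything that happened before that call. Damped Newton-CG. Inputs: $\epsilon_g>0$, $\epsilon_H\in(0,1)$, $\theta\in(0,1)$, $\zeta\in(0,1)$, $\eta>0$, starting point $x_0$, optional upper bound $M>0$ on the Hessian norm. For $k=0,1,2,\dots$: - If $\|\nabla f(x_k)\|>\epsilon_g$: call Capped CG with $H=\nabla^2f(x_k)$, $\epsilon=\epsilon_H$, $g=\nabla f(x_k)$, accuracy $\zeta$ (and $M$ if provided) to get $d$, d_type. If d_type=NC, set $d_k=-\mathrm{sgn}(d^\top g)\frac{|d^\top\nabla^2f(x_k)d|}{\|d\|^2}\frac{d}{\|d\|}$; if d_type=SOL, set $d_k=d$. - Otherwise call the Minimum Eigenvalue Oracle with $H=\nabla^2f(x_k)$, $\epsilon=\epsilon_H$ (and $M$ if provided). If it certifies $\lambda_{\min}(\nabla^2f(x_k))\ge-\epsilon_H$, terminate; else, with $v$ its output and $g=\nabla f(x_k)$, set $d_k=-\mathrm{sgn}(v^\top g)\frac{|v^\top\nabla^2f(x_k)v|}{\|v\|^2}v$. - Line search: $\alpha_k=\theta^{j_k}$ with $j_k$ the smallest nonnegative integer such that $f(x_k+\alpha_kd_k)<f(x_k)-\frac{\eta}{6}\alpha_k^3\|d_k\|^3$; set $x_{k+1}=x_k+\alpha_kd_k$. *)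

(* Defs.v *)
From HB Require Import structures.
From mathcomp Require Import all_boot all_order all_algebra.
From mathcomp Require Import all_classical all_reals all_analysis.

Set Implicit Arguments.
Unset Strict Implicit.
Unset Printing Implicit Defensive.

Import Order.TTheory GRing.Theory Num.Theory.
Import numFieldNormedType.Exports.

Local Open Scope classical_set_scope.
Local Open Scope ring_scope.

Section Euclidean.
Variables (R : realType) (n : nat).
Implicit Types (u v x : 'cV[R]_n) (A : 'M[R]_n).

Definition dot u v : R := \sum_(i < n) u i 0 * v i 0.

(* The library norm of a matrix is the maximum norm; it induces the same
   topology and the same notion of differentiability as the Euclidean norm. *)
Definition enorm u : R := Num.sqrt (dot u u).

Definition opnorm A : R :=
  sup [set enorm (A *m v) | v in [set v | enorm v <= 1]].

(* The set of eigenvalues is finite, and it is nonempty when A is symmetric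
   and n > 0, so that this infimum is then the smallest eigenvalue. *)
Definition lambda_min A : R := inf [set a : R | eigenvalue A a].

Definition gradient (f : 'cV[R]_n -> R) x : 'cV[R]_n :=
  \col_i 'D_(delta_mx i 0) f x.

Definition hessian (f : 'cV[R]_n -> R) x : 'M[R]_n :=
  \matrix_(i, j) 'D_(delta_mx j 0) (fun y => gradient f y i 0) x.

Definition twice_differentiable_on (U : set 'cV[R]_n) (f : 'cV[R]_n -> R) :=
  forall x, U x -> differentiable f x /\ differentiable (gradient f) x.

Definition hessian_lipschitz_on (U : set 'cV[R]_n) (L : R)
    (f : 'cV[R]_n -> R) :=
  forall x y, U x -> U y ->
    opnorm (hessian f x - hessian f y) <= L * enorm (x - y).

(* sgn 0 = 1, unlike Num.sg *)
Definition sgn1 (t : R) : R := if 0 <= t then 1 else -1.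

End Euclidean.

Section CappedCG.
Variables (R : realType) (n : nat).

Variant d_type := NC | SOL.

Record cg_state := CGState {cg_y : 'cV[R]_n; cg_r : 'cV[R]_n; cg_p : 'cV[R]_n}.

Variables (H : 'M[R]_n) (g : 'cV[R]_n) (eps zeta M0 : R).

Definition damped : 'M[R]_n := H + (2 * eps)%:M.

Definition cg_next (s : cg_state) : cg_state :=
  let: CGState y r p := s in
  let alpha := dot r r / dot p (damped *m p) in
  let r' := r + alpha *: (damped *m p) in
  let beta := dot r' r' / dot r r in
  CGState (y + alpha *: p) r' (- r' + beta *: p).

(* The recurrences do not depend on M nor on the outcome of the tests, so
   (y_j, r_j, p_j) is defined for all j, including those that the method
   does not reach because it has returned before. *)
Definition cg_iter (j : nat) : cg_state := iter j cg_next (CGState 0 g (- g)).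

Let y j := cg_y (cg_iter j).
Let r j := cg_r (cg_iter j).
Let p j := cg_p (cg_iter j).

Definition update_bound (M : R) (u : 'cV[R]_n) : R :=
  if M * enorm u < enorm (H *m u) then enorm (H *m u) / enorm u else M.

(* value of M when the tests at index j are applied *)
Fixpoint cg_bound (j : nat) : R :=
  match j with
  | 0 => update_bound M0 (p 0)
  | j'.+1 =>
      update_bound (update_bound (update_bound (cg_bound j') (p j)) (y j)) (r j)
  end.

Definition cg_kappa (M : R) : R := (M + 2 * eps) / eps.
Definition cg_zeta_hat (M : R) : R := zeta / (3 * cg_kappa M).
Definition cg_tau (M : R) : R :=
  Num.sqrt (cg_kappa M) / (Num.sqrt (cg_kappa M) + 1).
Definition cg_T (M : R) : R :=
  4 * cg_kappa M ^+ 4 / (1 - Num.sqrt (cg_tau M)) ^+ 2.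

Definition low_curvature (u : 'cV[R]_n) : bool :=
  dot u (damped *m u) < eps * enorm u ^+ 2.

Definition small_residual (j : nat) : bool :=
  enorm (r j) <= cg_zeta_hat (cg_bound j) * enorm (r 0).

Definition slow_residual (j : nat) : bool :=
  Num.sqrt (cg_T (cg_bound j)) * cg_tau (cg_bound j) `^ (j%:R / 2)
    * enorm (r 0) < enorm (r j).

Definition cg_stops (j : nat) : bool :=
  [|| low_curvature (y j), small_residual j, low_curvature (p j)
    | slow_residual j].

(* A relation because the index i of the last test is not specified; the
   existence of a suitable i is not presupposed. *)
Definition cg_returns (j : nat) (out : 'cV[R]_n * d_type) : Prop :=
  if low_curvature (y j) then out = (y j, NC)
  else if small_residual j then out = (y j, SOL)
  else if low_curvature (p j) then out = (p j, NC)
  else slow_residual j /\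
    exists i, [/\ (i < j)%N, low_curvature (y j.+1 - y i)
                & out = (y j.+1 - y i, NC)].

Definition capped_cg (out : 'cV[R]_n * d_type) : Prop :=
  if low_curvature (p 0) then out = (p 0, NC)
  else exists j, [/\ (0 < j)%N, forall i, (0 < i < j)%N -> ~~ cg_stops i
                   & cg_returns j out].

End CappedCG.

Section NewtonCG.
Variables (R : realType) (n : nat).

Variant meo_answer := Certificate | NegativeCurvature of R & 'cV[R]_n.

Definition is_certificate (a : meo_answer) : bool :=
  if a is Certificate then true else false.

Definition meo_answer_valid (H : 'M[R]_n) (eps : R) (a : meo_answer) : Prop :=
  match a with
  | Certificate => True
  | NegativeCurvature lambda v =>
      [/\ lambda <= - (eps / 2), enorm v = 1 & dot v (H *m v) = lambda]
  end.

Record newton_cg_params := NewtonCGParams {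
  eps_g : R; eps_H : R; theta : R; zeta : R; eta : R;
  hess_bound : option R  (* the optional input M *)
}.

Variables (prm : newton_cg_params) (f : 'cV[R]_n -> R).

(* State at the start of an iteration. Diverged is reached when a call to
   capped CG or a line search does not return. *)
Variant status :=
  Running of 'cV[R]_n | Terminated of 'cV[R]_n | Diverged.

Definition running_at (Q : 'cV[R]_n -> Prop) (s : status) : Prop :=
  if s is Running x then Q x else False.
Definition terminated_at (Q : 'cV[R]_n -> Prop) (s : status) : Prop :=
  if s is Terminated x then Q x else False.

Definition cg_direction (H : 'M[R]_n) (g : 'cV[R]_n)
    (out : 'cV[R]_n * d_type) : 'cV[R]_n :=
  let: (d, t) := out in
  match t with
  | NC => - (sgn1 (dot d g) * (`|dot d (H *m d)| / enorm d ^+ 2))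
            *: ((enorm d)^-1 *: d)
  | SOL => d
  end.

Definition meo_direction (H : 'M[R]_n) (g v : 'cV[R]_n) : 'cV[R]_n :=
  - (sgn1 (dot v g) * (`|dot v (H *m v)| / enorm v ^+ 2)) *: v.

(* d is a search direction at x; the oracle answer a is used only when the
   gradient is small *)
Definition search_direction (x : 'cV[R]_n) (a : meo_answer) (d : 'cV[R]_n)
    : Prop :=
  let g := gradient f x in
  let H := hessian f x in
  if eps_g prm < enorm g then
    exists2 out, capped_cg H g (eps_H prm) (zeta prm)
                   (odflt 0 (hess_bound prm)) out
               & d = cg_direction H g out
  else
    match a with
    | Certificate => False
    | NegativeCurvature _ v => d = meo_direction H g v
    end.

Definition trial_point (x d : 'cV[R]_n) (j : nat) : 'cV[R]_n :=
  x + theta prm ^+ j *: d.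

Definition sufficient_decrease (x d : 'cV[R]_n) (j : nat) : bool :=
  f (trial_point x d j)
    < f x - eta prm / 6 * (theta prm ^+ j) ^+ 3 * enorm d ^+ 3.

Definition line_search (x d : 'cV[R]_n) (s' : status) : Prop :=
  (exists j, [/\ sufficient_decrease x d j,
                 forall i, (i < j)%N -> ~~ sufficient_decrease x d i
               & s' = Running (trial_point x d j)])
  \/ ((forall j, ~~ sufficient_decrease x d j) /\ s' = Diverged).

Definition newton_cg_step (a : meo_answer) (d : 'cV[R]_n) (s s' : status)
    : Prop :=
  match s with
  | Running x =>
      if (enorm (gradient f x) <= eps_g prm) && is_certificate a
      then s' = Terminated x
      else (search_direction x a d /\ line_search x d s')
           \/ ((forall d', ~ search_direction x a d') /\ s' = Diverged)
  | _ => s' = s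
  end.

Definition newton_cg_run (x0 : 'cV[R]_n) (ans : nat -> meo_answer)
    (dir : nat -> 'cV[R]_n) (st : nat -> status) : Prop :=
  st 0%N = Running x0
  /\ forall k, newton_cg_step (ans k) (dir k) (st k) (st k.+1).

(* the points at which a run evaluates f in its line searches *)
Definition run_trial_points (ans : nat -> meo_answer)
    (dir : nat -> 'cV[R]_n) (st : nat -> status) : set 'cV[R]_n :=
  [set z | exists k x j,
     [/\ st k = Running x, search_direction x (ans k) (dir k),
         forall i, (i < j)%N -> ~~ sufficient_decrease x (dir k) i
       & z = trial_point x (dir k) j]].

Definition calls_oracle (s : status) : Prop :=
  running_at (fun x => enorm (gradient f x) <= eps_g prm) s.

Definition hessian_above (s : status) : Prop :=
  running_at (fun x => - eps_H prm <= lambda_min (hessian f x)) s.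

Definition valid_answer (s : status) (a : meo_answer) : Prop :=
  running_at (fun x => meo_answer_valid (hessian f x) (eps_H prm) a) s.

Definition N_meo (C_meo : R) : int :=
  Num.min n%:Z (1 + Num.ceil (C_meo * eps_H prm `^ (- 2^-1))).

(* N is the number of Hessian-vector products used by the call *)
Definition oracle_success (C_meo : R) (s : status) (a : meo_answer) (N : nat)
    : Prop :=
  running_at (fun x =>
    match a with
    | Certificate => - eps_H prm <= lambda_min (hessian f x)
    | NegativeCurvature _ v => dot v (hessian f x *m v) <= - (eps_H prm / 2)
    end /\ N%:Z <= N_meo C_meo) s.

Definition c_sol (L_H : R) : R :=
  eta prm / 6 * Num.min
    ((4 / (Num.sqrt ((4 + zeta prm) ^+ 2 + 8 * L_H) + 4 + zeta prm)) ^+ 3)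
    ((3 * theta prm ^+ 2 * (1 - zeta prm) / (L_H + eta prm)) ^+ 3).

Definition c_nc (L_H : R) : R :=
  eta prm / 6 * Num.min 1 (27 * theta prm ^+ 3 / (L_H + eta prm) ^+ 3).

(* The ceiling is nonnegative when f_low <= f x0, so that the absolute value
   is then a mere conversion from int to nat. *)
Definition K2bar (L_H f_low : R) (x0 : 'cV[R]_n) : nat :=
  let c := Num.ceil (3 * (f x0 - f_low) / Num.min (c_sol L_H) (c_nc L_H / 8)
    * Num.max (eps_g prm ^- 3 * eps_H prm ^+ 3) (eps_H prm ^- 3)) in
  (absz c + 2)%N.

End NewtonCG.

Arguments Certificate {R n}.
Arguments Diverged {R n}.

(* C is a function of the failure probability and of the tolerance *)
Definition at_most_logarithmic (R : realType) (C : R -> R -> R) : Prop :=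
  exists a : R, forall delta eps : R, 0 < delta < 1 -> 0 < eps < 1 ->
    C delta eps <= a * (1 + `|ln delta| + `|ln eps|).

Section Probability.
Variables (R : realType) (disp : measure_display) (Omega : measurableType disp).

Definition filtration (F : nat -> set (set Omega)) : Prop :=
  [/\ forall k, sigma_algebra setT (F k),
      forall k, F k `<=` measurable
    & forall k, F k `<=` F k.+1].

Variables (n : nat) (prm : newton_cg_params R) (f : 'cV[R]_n -> R).
Variables (ans : nat -> Omega -> meo_answer R n) (nprod : nat -> Omega -> nat).
Variable st : nat -> Omega -> status R n.

Definition oracle_called (k : nat) : set Omega :=
  [set w | calls_oracle prm f (st k w)].

(* F k represents what happened before the oracle call of iteration k. Only
   the events about the iterates and about the oracle that are used below are
   required to be observable; they are when the iterates and the answers are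
   Borel measurable with respect to F k and F k.+1, respectively. *)
Definition adapted (F : nat -> set (set Omega)) : Prop :=
  forall k,
    [/\ F k (oracle_called k),
        F k (oracle_called k `&` [set w | hessian_above prm f (st k w)]),
        F k.+1 (oracle_called k `&` [set w | is_certificate (ans k w)])
      & forall m, F k.+1 (oracle_called k `&` [set w | nprod k w = m])].

(* The conditional probability of success given F k is at least 1 - delta
   almost everywhere on the event that the oracle is called; this is the
   integrated form of the inequality over all events of F k. *)
Definition oracle_reliable (P : probability Omega R)
    (F : nat -> set (set Omega)) (C_meo delta : R) : Prop :=
  forall k (A : set Omega), F k A ->
    ((1 - delta)%:E * P (A `&` oracle_called k)
      <= P (A `&` oracle_called k `&`
            [set w | oracle_success prm f C_meo (st k w) (ans k w)
                       (nprod k w)]))%E.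

End Probability.

(* Main.v *)
Require Import Defs.
From mathcomp Require Import all_boot all_order all_algebra.
From mathcomp Require Import all_classical all_reals all_analysis.
From mathcomp Require Import ring lra.

Import Order.TTheory GRing.Theory Num.Theory.
Import numFieldNormedType.Exports.

Local Open Scope classical_set_scope.
Local Open Scope ring_scope.

(** The theorem has a deterministic half and a probabilistic half.

    Deterministic half: every run terminates within K2bar steps, whatever the
    oracle answers, as long as an answer of negative curvature is valid. Each
    step from a running state falls in one of three cases.
    - A direction found by capped CG or by the oracle, whose curvature is below
      minus eps_H or minus eps_H / 2, is scaled so that its length is the
      absolute value of the curvature.
      The quadratic term of the Taylor model is then of order three in the
      length, and backtracking yields a decrease of order eps_H ^ 3
      (curvature_line_search).
    - An inexact damped Newton step yields a decrease of order
      min (norm of the next gradient / eps_H, eps_H) ^ 3 (newton_line_search).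
    - At a small gradient, a certificate terminates the run.
    Hence every step decreases f by a fixed amount, except Newton steps that
    enter the region of small gradients; such a step is followed by
    termination or by a step along negative curvature. At least every second
    step thus decreases f by that amount, which is impossible for K2bar steps
    because f is bounded below on the level set (run_invariant,
    run_terminates).

    Capped CG has to return for this to make sense. Its residuals are
    orthogonal, so it stops after at most n steps. In the delicate case of a
    slowly decreasing residual, a direction y (j+1) - y i of low curvature must
    exist: if there were none, the quadratic model would be strongly convex
    along the segments from the iterates y i to y (j+1). Nesterov's estimate
    sequence for strongly convex functions uses convexity along these segments
    only, and forces the residual to be small (cg_estimate_sequence, cg_rate,
    slow_residual_negative_curvature).

    The neighbourhood U of the level set need not be convex, so Taylor bounds
    are not available between arbitrary points. They are only applied on the
    initial part of a ray on which f stays below its initial value; a first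
    crossing argument shows that this part is as long as the model predicts
    (model_decreases_decreases). A Newton step of length less than
    3 eps_H / (L + eta) is entirely in that part, which gives access to the
    gradient at its end; a longer step decreases f enough by its length.

    Probabilistic half: since every run terminates, the run is incorrect
    exactly when one of the first K2bar oracle calls returns a wrong
    certificate. Given the past this has probability at most delta, so all
    calls are right with probability at least (1 - delta) ^ K2bar
    (no_failure_probability). *)

(** * Euclidean geometry *)

Section DotProduct.
Context {R : realType} {n : nat}.
Implicit Types (u v w : 'cV[R]_n) (A : 'M[R]_n) (a : R).

Lemma dotC u v : dot u v = dot v u.
Proof. by apply: eq_bigr => i _; rewrite mulrC. Qed.

Lemma dotDl u v w : dot (u + v) w = dot u w + dot v w.
Proof. by rewrite -big_split; apply: eq_bigr => i _; rewrite mxE mulrDl. Qed.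

Lemma dotZl a u v : dot (a *: u) v = a * dot u v.
Proof. by rewrite mulr_sumr; apply: eq_bigr => i _; rewrite mxE mulrA. Qed.

Lemma dotNl u v : dot (- u) v = - dot u v.
Proof. by rewrite -scaleN1r dotZl mulN1r. Qed.

Lemma dot0l v : dot 0 v = 0.
Proof. by rewrite -(scale0r v) dotZl mul0r. Qed.

Lemma dotDr u v w : dot u (v + w) = dot u v + dot u w.
Proof. by rewrite dotC dotDl !(dotC u). Qed.

Lemma dotZr a u v : dot u (a *: v) = a * dot u v.
Proof. by rewrite dotC dotZl dotC. Qed.

Lemma dotNr u v : dot u (- v) = - dot u v.
Proof. by rewrite dotC dotNl dotC. Qed.

Lemma dot0r v : dot v 0 = 0.
Proof. by rewrite dotC dot0l. Qed.

Definition dot_linear := (dotDl, dotDr, dotNl, dotNr, dotZl, dotZr, dot0l, dot0r).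

Lemma dot_mulmx u A v : dot u (A *m v) = dot (A^T *m u) v.
Proof.
have -> : dot u (A *m v) = \sum_i \sum_j u i 0 * (A i j * v j 0).
  by apply: eq_bigr => i _; rewrite mxE mulr_sumr.
rewrite exchange_big; apply: eq_bigr => j _ /=; rewrite mxE mulr_suml.
by apply: eq_bigr => i _; rewrite mxE; ring.
Qed.

Lemma dot_sym u A v : A^T = A -> dot u (A *m v) = dot v (A *m u).
Proof. by move=> symA; rewrite dot_mulmx symA dotC. Qed.

Lemma dot_ge0 u : 0 <= dot u u.
Proof. by apply: sumr_ge0 => i _; rewrite -expr2 sqr_ge0. Qed.

Lemma dot_eq0 u : (dot u u == 0) = (u == 0).
Proof.
rewrite psumr_eq0 => [|i _]; last by rewrite -expr2 sqr_ge0.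
apply/allP/eqP => [u0|-> i _]; last by rewrite mxE mul0r eqxx.
apply/colP => i; rewrite mxE; apply/eqP; rewrite -[_ == _]orbb -mulf_eq0.
exact: u0 (mem_index_enum i).
Qed.

Lemma dot_gt0 u : (0 < dot u u) = (u != 0).
Proof. by rewrite lt0r dot_eq0 dot_ge0 andbT. Qed.

Lemma enorm_ge0 u : 0 <= enorm u.
Proof. exact: sqrtr_ge0. Qed.

Lemma enorm_sq u : enorm u ^+ 2 = dot u u.
Proof. exact/sqr_sqrtr/dot_ge0. Qed.

Lemma enorm_eq0 u : (enorm u == 0) = (u == 0).
Proof. by rewrite -[LHS](sqrf_eq0 (enorm u)) enorm_sq dot_eq0. Qed.

Lemma enorm_gt0 u : (0 < enorm u) = (u != 0).
Proof. by rewrite lt0r enorm_eq0 enorm_ge0 andbT. Qed.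

Lemma enorm0 : enorm (0 : 'cV[R]_n) = 0.
Proof. by apply/eqP; rewrite enorm_eq0. Qed.

Lemma enormZ a u : enorm (a *: u) = `|a| * enorm u.
Proof.
by rewrite /enorm dotZl dotZr mulrA -expr2 sqrtrM ?sqr_ge0// sqrtr_sqr.
Qed.

Lemma enormN u : enorm (- u) = enorm u.
Proof. by rewrite -scaleN1r enormZ normrN1 mul1r. Qed.

Lemma enorm_normalize u : u != 0 -> enorm ((enorm u)^-1 *: u) = 1.
Proof.
move=> u0; rewrite enormZ ger0_norm ?invr_ge0 ?enorm_ge0// mulVf//.
by rewrite enorm_eq0.
Qed.

Lemma dot_sq_le u v : dot u v ^+ 2 <= dot u u * dot v v.
Proof.
have [->|v0] := eqVneq v 0; first by rewrite !dot_linear expr0n mulr0.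
have vv0 : 0 < dot v v by rewrite dot_gt0.
(* dot v v times the component of u orthogonal to v *)
have := dot_ge0 (dot v v *: u - dot u v *: v).
rewrite !dot_linear (dotC v u).
rewrite (_ : _ + _ = dot v v * (dot u u * dot v v - dot u v ^+ 2)); last ring.
by rewrite pmulr_rge0// subr_ge0.
Qed.

Lemma cauchy_schwarz u v : `|dot u v| <= enorm u * enorm v.
Proof.
rewrite -[leLHS]sqrtr_sqr -sqrtrM ?dot_ge0// ler_wsqrtr//; exact: dot_sq_le.
Qed.

Lemma dot_le u v : dot u v <= enorm u * enorm v.
Proof. exact: le_trans (ler_norm _) (cauchy_schwarz u v). Qed.

Lemma enormD u v : enorm (u + v) <= enorm u + enorm v.
Proof.
rewrite -ler_sqr ?nnegrE ?addr_ge0 ?enorm_ge0// enorm_sq !dot_linear (dotC v u).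
by have := dot_le u v; rewrite -!enorm_sq; nra.
Qed.

(** Cauchy-Schwarz for each row of A; the supremum that defines the operator
    norm is therefore finite. *)
Lemma enorm_mulmx_bounded A : exists2 C, 0 <= C &
  forall v, enorm (A *m v) <= C * enorm v.
Proof.
exists (Num.sqrt (\sum_i dot (row i A)^T (row i A)^T)) => [|v].
  exact: sqrtr_ge0.
have C0 : 0 <= \sum_i dot (row i A)^T (row i A)^T.
  by apply: sumr_ge0 => i _; exact: dot_ge0.
rewrite -sqrtrM// ler_wsqrtr// mulr_suml; apply: ler_sum => i _.
rewrite -expr2; apply: le_trans (dot_sq_le _ _).
rewrite (_ : (A *m v) i 0 = dot (row i A)^T v)// mxE.
by apply: eq_bigr => j _; rewrite !mxE.
Qed.

Let opnorm_set A := [set enorm (A *m v) | v in [set v | enorm v <= 1]].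

Let opnorm_has_sup A : has_sup (opnorm_set A).
Proof.
split; first by exists (enorm (A *m 0)), 0 => //=; rewrite enorm0.
have [C C0 AC] := enorm_mulmx_bounded A.
exists C => _ [v /= v1 <-]; apply: le_trans (AC v) _; nra.
Qed.

Lemma opnorm_ge0 A : 0 <= opnorm A.
Proof.
apply: ub_le_sup; first by have [] := opnorm_has_sup A.
by exists 0 => /=; rewrite ?mulmx0 enorm0.
Qed.

Lemma enorm_mulmx A v : enorm (A *m v) <= opnorm A * enorm v.
Proof.
have [->|v0] := eqVneq v 0; first by rewrite mulmx0 enorm0 mulr0.
have vgt0 : 0 < enorm v by rewrite enorm_gt0.
have : enorm (A *m ((enorm v)^-1 *: v)) <= opnorm A.
  apply: ub_le_sup; first by have [] := opnorm_has_sup A.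
  by exists ((enorm v)^-1 *: v) => //=; rewrite enorm_normalize.
rewrite -scalemxAr enormZ ger0_norm ?invr_ge0 ?enorm_ge0//.
by rewrite mulrC ler_pdivrMr.
Qed.

Lemma dot_mulmx_le u A v : `|dot u (A *m v)| <= opnorm A * enorm u * enorm v.
Proof.
apply: le_trans (cauchy_schwarz _ _) _.
by have := enorm_mulmx A v; have := enorm_ge0 u; nra.
Qed.

End DotProduct.

(** * Conjugate gradients *)

(** The Gram matrix of the family is diagonal without zeros on the diagonal,
    hence invertible, so its rank m is at most the dimension n. *)
Lemma orthogonal_family_small {R : realType} {n : nat} (m : nat)
    (u : nat -> 'cV[R]_n) :
  (forall i, (i < m)%N -> u i != 0) ->
  (forall i j, (i < j < m)%N -> dot (u j) (u i) = 0) -> (m <= n)%N.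
Proof.
move=> u0 uorth; pose A : 'M[R]_(m, n) := \matrix_(i < m) (u i)^T.
have AAT : A *m A^T = diag_mx (\row_i dot (u (i : 'I_m)) (u i)).
  apply/matrixP => i j; rewrite !mxE.
  transitivity (dot (u i) (u j)).
    by apply: eq_bigr => k _; rewrite !mxE.
  have [->|ij] := eqVneq i j; first by rewrite mulr1n.
  rewrite mulr0n; have [lt_ij|lt_ji|eq_ij] := ltngtP i j.
  - by rewrite dotC uorth// lt_ij /=.
  - by rewrite uorth// lt_ji /=.
  - by move/val_inj: eq_ij ij => ->; rewrite eqxx.
have : A *m A^T \in unitmx.
  rewrite unitmxE AAT det_diag unitfE; apply/prodf_neq0 => i _.
  by rewrite mxE dot_eq0 u0.
by move/mxrank_unit => <-; exact: leq_trans (mxrankM_maxl _ _) (rank_leq_col _).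
Qed.

Section ConjugateGradient.
Context {R : realType} {n : nat}.
Variables (H : 'M[R]_n) (g : 'cV[R]_n) (eps : R).
Hypothesis symH : H^T = H.

Local Notation B := (damped H eps).
Local Notation y j := (cg_y (cg_iter H g eps j)).
Local Notation r j := (cg_r (cg_iter H g eps j)).
Local Notation p j := (cg_p (cg_iter H g eps j)).
Let alpha j := dot (r j) (r j) / dot (p j) (B *m p j).
Let beta j := dot (r j.+1) (r j.+1) / dot (r j) (r j).

Lemma damped_sym : B^T = B.
Proof. by rewrite linearD /= symH tr_scalar_mx. Qed.

Let dotB u v : dot u (B *m v) = dot v (B *m u).
Proof. exact/dot_sym/damped_sym. Qed.

Lemma cg_yS j : y j.+1 = y j + alpha j *: p j.
Proof. by rewrite /alpha /=; case: (cg_iter _ _ _ j). Qed.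

Lemma cg_rS j : r j.+1 = r j + alpha j *: (B *m p j).
Proof. by rewrite /alpha /=; case: (cg_iter _ _ _ j). Qed.

Lemma cg_pS j : p j.+1 = - r j.+1 + beta j *: p j.
Proof. by rewrite /beta /=; case: (cg_iter _ _ _ j). Qed.

Lemma cg_residual j : r j = g + B *m y j.
Proof.
elim: j => [|j IH]; first by rewrite mulmx0 addr0.
by rewrite cg_rS cg_yS IH mulmxDr -scalemxAr addrA.
Qed.

Lemma cg_r0 : r 0 = - p 0.
Proof. by rewrite opprK. Qed.

(** Read backwards, the recurrence of the directions expresses a residual by
    two directions; orthogonality to directions thus gives orthogonality to
    residuals. *)
Lemma cg_r_dir j : r j.+1 = - p j.+1 + beta j *: p j.
Proof. by rewrite cg_pS opprD opprK subrK. Qed.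

Section Conjugacy.
Variable J : nat.
Hypothesis p_pos : forall i, (i < J)%N -> 0 < dot (p i) (B *m p i).

Let r_neq0 i : (i < J)%N -> r i != 0.
Proof.
move=> iJ; apply/eqP => ri0; have := p_pos i iJ.
suff -> : p i = 0 by rewrite dot0l ltxx.
case: i ri0 {iJ} => [|i] ri0; first by rewrite -[p 0]/(- r 0) ri0 oppr0.
by rewrite cg_pS /beta ri0 dot0l mul0r scale0r oppr0 addr0.
Qed.

Let alpha_gt0 i : (i < J)%N -> 0 < alpha i.
Proof. by move=> iJ; rewrite divr_gt0 ?dot_gt0 ?r_neq0 ?p_pos. Qed.

(** A step minimizes the model along p j, so the new residual is orthogonal to
    p j, and by conjugacy it remains orthogonal to the earlier directions.
    As B *m p i is a multiple of r i.+1 - r i, the new residual is conjugate to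
    p i for i < j, and the coefficient beta makes p j.+1 conjugate to p j. *)
Lemma cg_conjugacy j : (j <= J)%N ->
  [/\ forall i, (i < j)%N -> dot (r j) (p i) = 0,
      forall i, (i < j)%N -> dot (p j) (B *m p i) = 0
    & dot (r j) (p j) = - dot (r j) (r j)].
Proof.
elim: j => [_|j IH jJ].
  by split => //; rewrite -[p 0]/(- r 0) dotNr.
have [rp pBp rpj] := IH (ltnW jJ).
have pBj := p_pos j jJ.
have rp' i : (i < j.+1)%N -> dot (r j.+1) (p i) = 0.
  rewrite ltnS leq_eqVlt => /predU1P[->|ij].
    rewrite cg_rS !dot_linear rpj (dotC (B *m p j)) /alpha divfK ?gt_eqF//.
    by rewrite addNr.
  by rewrite cg_rS !dot_linear rp// (dotC (B *m p j)) dotB pBp// mulr0 addr0.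
have rr' i : (i < j.+1)%N -> dot (r j.+1) (r i) = 0.
  case: i => [|i] ij; first by rewrite cg_r0 dotNr rp'// oppr0.
  by rewrite (cg_r_dir i) !dot_linear !rp'// 1?ltnW//; ring.
have rBp i : (i < J)%N ->
    dot (r j.+1) (B *m p i) = (dot (r j.+1) (r i.+1) - dot (r j.+1) (r i)) / alpha i.
  move=> iJ; rewrite (cg_rS i) !dot_linear addrAC subrr add0r mulrC mulKf//.
  by rewrite gt_eqF// alpha_gt0.
split=> // [i|]; last by rewrite [X in dot _ X]cg_pS !dot_linear rp'//; ring.
rewrite ltnS leq_eqVlt => /predU1P[->|ij].
  rewrite cg_pS !dot_linear rBp// (rr' j)// subr0 /alpha /beta.
  by field; rewrite dot_eq0 r_neq0 //= gt_eqF.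
rewrite cg_pS !dot_linear rBp ?(ltn_trans ij)// (rr' i.+1)// (rr' i) ?ltnS 1?ltnW//.
by rewrite pBp//; ring.
Qed.

Lemma cg_residuals_orthogonal i j : (i < j <= J)%N -> dot (r j) (r i) = 0.
Proof.
case/andP => ij jJ; have [rp _ _] := cg_conjugacy j jJ.
case: i ij => [|i] ij; first by rewrite cg_r0 dotNr rp// oppr0.
by rewrite (cg_r_dir i) !dot_linear !rp// 1?ltnW//; ring.
Qed.

Lemma cg_residual_iterate i j : (i <= j <= J)%N -> dot (r j) (y i) = 0.
Proof.
case/andP => + jJ; elim: i => [_|i IH ij]; first by rewrite dot0r.
have [rp _ _] := cg_conjugacy j jJ.
by rewrite cg_yS !dot_linear IH ?rp ?(ltnW ij)//; ring.
Qed.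

(** The directions are conjugate and r j = - p j + beta p (j - 1), so the
    curvature along r j is the one along p j plus a nonnegative term. *)
Lemma cg_curvature_residual j : (j <= J)%N ->
  dot (p j) (B *m p j) <= dot (r j) (B *m r j).
Proof.
case: j => [_|j jJ].
  by rewrite -[p 0]/(- r 0) !(mulmxN, dot_linear) opprK.
have [_ pBp _] := cg_conjugacy j.+1 jJ.
rewrite (cg_r_dir j) !(mulmxDr, mulmxN, dot_linear) -scalemxAr !dot_linear.
rewrite (dotB (p j) (p j.+1)) (pBp j)//.
by have := p_pos j jJ; have := sqr_ge0 (beta j); nra.
Qed.

End Conjugacy.

(** The iterates of CG minimize this quadratic over growing subspaces. *)
Definition cg_model (z : 'cV[R]_n) : R := dot z (B *m z) / 2 + dot g z.

Lemma cg_model_expand j z :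
  cg_model z = cg_model (y j) + dot (r j) (z - y j)
    + dot (z - y j) (B *m (z - y j)) / 2.
Proof.
rewrite /cg_model cg_residual !(mulmxDr, mulmxN, dot_linear).
by rewrite !(dotC (B *m y j)) !(dotB (y j)); field.
Qed.

(** The exact step along p J gains half of (r J . r J)^2 / (p J . B p J), and
    the curvature along p J is at most the one along r J. *)
Lemma cg_model_decrease J L : (forall i, (i <= J)%N -> 0 < dot (p i) (B *m p i)) ->
  0 < L -> dot (r J) (B *m r J) <= L * dot (r J) (r J) ->
  cg_model (y J.+1) <= cg_model (y J) - dot (r J) (r J) / (2 * L).
Proof.
move=> p_pos L0 rL.
have p_posJ i : (i < J)%N -> 0 < dot (p i) (B *m p i) by move/ltnW/p_pos.
have [_ _ rp] := cg_conjugacy J p_posJ J (leqnn J).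
have pBp := p_pos J (leqnn J).
rewrite (cg_model_expand J (y J.+1)) cg_yS.
rewrite (addrC (y J)) addrK.
rewrite -scalemxAr !dot_linear rp /alpha.
have rr0 := dot_ge0 (r J).
have pL := le_trans (cg_curvature_residual J p_posJ J (leqnn J)) rL.
set a := dot (r J) (r J) in rr0 rp pL *; set b := dot (p J) _ in pBp pL *.
rewrite (_ : _ + _ = cg_model (y J) - (a / b) * a / 2); last first.
  by field; rewrite gt_eqF.
have : a / L <= a / b * a.
  rewrite ler_pdivrMr// (_ : a / b * a * L = a * (L * a) / b); last by field; rewrite gt_eqF.
  by rewrite ler_pdivlMr// ler_wpM2l.
rewrite (_ : a / (2 * L) = a / L / 2); last by field; rewrite gt_eqF.
lra.
Qed.

(** Nesterov's estimate sequence. The lower bounds on the model at w that it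
    combines come from the tangents at the iterates y i, and need strong
    convexity only along the segments from y i to w. The orthogonality of the
    residual to the previous iterates plays the part of the momentum step. The
    point v of the induction is the minimizer of the estimating quadratic. It
    lies in the span of the residuals r i with i < j, hence is orthogonal to the
    later ones. *)
Lemma cg_estimate_sequence J kappa (w : 'cV[R]_n) :
  0 < eps -> 1 <= kappa ->
  (forall i, (i < J)%N -> 0 < dot (p i) (B *m p i)) ->
  (forall i, (i < J)%N -> dot (r i) (B *m r i) <= kappa * eps * dot (r i) (r i)) ->
  (forall i, (i < J)%N ->
     eps * dot (w - y i) (w - y i) <= dot (w - y i) (B *m (w - y i))) ->
  cg_model (y J) <= cg_model w
    + (1 - (Num.sqrt kappa)^-1) ^+ J * (- cg_model w + eps / 2 * dot w w).
Proof.
move=> eps0 k1 p_pos rL wcurv; set a := (Num.sqrt kappa)^-1.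
have k0 : 0 < kappa by lra.
have sk : Num.sqrt kappa ^+ 2 = kappa by rewrite sqr_sqrtr// ltW.
have sk1 : 1 <= Num.sqrt kappa by rewrite -sqrtr1 ler_sqrt ?ltr01// ltW.
have a0 : 0 < a by rewrite invr_gt0; lra.
have a1 : a <= 1 by rewrite invf_le1//; lra.
have a2 : kappa^-1 = a ^+ 2 by rewrite /a exprVn sk.
suff main j : (j <= J)%N -> exists2 v,
    forall m, (j <= m <= J)%N -> dot (r m) v = 0
  & cg_model (y j) + eps / 2 * dot (w - v) (w - v) <= cg_model w
    + (1 - a) ^+ j * (- cg_model w + eps / 2 * dot w w).
  have [v _] := main J (leqnn J); apply: le_trans.
  by rewrite lerDl mulr_ge0 ?dot_ge0//; lra.
elim: j => [_|j IH jJ].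
  exists 0 => [m _|]; first by rewrite dot0r.
  rewrite -[y 0]/(0 : 'cV[R]_n) subr0 expr0 mul1r /cg_model mulmx0 !dot_linear.
  by lra.
have [v rv qv] := IH (ltnW jJ).
exists ((1 - a) *: v + a *: y j - (a / eps) *: r j) => [m /andP[jm mJ]|].
  rewrite !dot_linear rv ?(ltnW jm)//.
  rewrite (cg_residual_iterate J p_pos j m) ?(ltnW jm)//.
  by rewrite (cg_residuals_orthogonal J p_pos j m) ?jm//; ring.
have rLj := rL j jJ.
have dec : cg_model (y j.+1) <= cg_model (y j) - dot (r j) (r j) * a ^+ 2 / (2 * eps).
  rewrite -a2.
  have p_pos' i : (i <= j)%N -> 0 < dot (p i) (B *m p i).
    by move=> ij; apply: p_pos; rewrite (leq_ltn_trans ij).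
  have ke : 0 < kappa * eps by rewrite mulr_gt0.
  rewrite (_ : _ / (2 * eps) = dot (r j) (r j) / (2 * (kappa * eps))); last first.
    by field; rewrite !gt_eqF.
  exact: cg_model_decrease p_pos' ke rLj.
have rv0 : dot (r j) v = 0 by rewrite rv// leqnn ltnW.
have ry0 : dot (r j) (y j) = 0.
  by rewrite (cg_residual_iterate J p_pos j j)// leqnn ltnW.
have conv : cg_model (y j) + dot (r j) w + eps / 2 * dot (w - y j) (w - y j)
    <= cg_model w.
  have : dot (r j) (w - y j) = dot (r j) w by rewrite dotDr dotNr ry0 subr0.
  by have := wcurv j jJ; have := cg_model_expand j w; lra.
rewrite exprS.
have -> : eps / 2 * dot (w - ((1 - a) *: v + a *: y j - (a / eps) *: r j))
              (w - ((1 - a) *: v + a *: y j - (a / eps) *: r j))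
  = (1 - a) * (eps / 2 * dot (w - v) (w - v))
    + a * (eps / 2 * dot (w - y j) (w - y j))
    - eps / 2 * (a * (1 - a) * dot (v - y j) (v - y j))
    + dot (r j) (r j) * a ^+ 2 / (2 * eps) + a * dot (r j) w.
  rewrite !dot_linear (dotC v (r j)) (dotC w (r j)) (dotC (y j) (r j)) rv0 ry0.
  by rewrite (dotC v w) (dotC (y j) w) (dotC (y j) v); field; rewrite gt_eqF.
have vy := dot_ge0 (v - y j); have ww := dot_ge0 (w - v).
set Q := (1 - a) ^+ j * _ in qv *.
rewrite -(mulrA (1 - a)) -/Q.
set D := _ / (2 * eps) in dec *.
have qa := ler_wpM2l (_ : 0 <= 1 - a) qv.
have {}qa : (1 - a) * (cg_model (y j) + eps / 2 * dot (w - v) (w - v))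
   <= (1 - a) * (cg_model w + Q) by apply: qa; lra.
have ca := ler_wpM2l (ltW a0) conv.
have av : 0 <= eps / 2 * (a * (1 - a) * dot (v - y j) (v - y j)).
  by rewrite !mulr_ge0//; lra.
lra.
Qed.

(** At the minimizer w of the model over the subspace, g . w = - w . B w, so
    that the model is g . w / 2 there, and eps |w|^2 <= - g . w <= |g| |w|
    bounds - g . w by |g|^2 / eps. *)
Lemma cg_optimal_bound J : 0 < eps ->
  (forall i, (i <= J)%N -> 0 < dot (p i) (B *m p i)) ->
  let w := y J.+1 in eps * dot w w <= dot w (B *m w) ->
  - cg_model w + eps / 2 * dot w w <= dot g g / eps.
Proof.
move=> eps0 p_pos w wcurv.
have rw : dot g w + dot w (B *m w) = 0.
  rewrite -(cg_residual_iterate J.+1 p_pos J.+1 J.+1) ?leqnn//.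
  by rewrite cg_residual dotDl (dotC (B *m _)).
have gw := dot_sq_le g w; have ww := dot_ge0 w; have gg := dot_ge0 g.
have eww : eps * dot w w <= - dot g w by lra.
suff gw_le : - dot g w <= dot g g / eps by rewrite /cg_model; lra.
rewrite ler_pdivlMr// mulrC.
have [gw0|gw0] := ltP (dot g w) 0; last first.
  by apply: le_trans gg; rewrite pmulr_rle0//; lra.
rewrite -(ler_pM2r (_ : 0 < - dot g w)); last by lra.
apply: le_trans (_ : eps * (dot g g * dot w w) <= _); last by nra.
by have := ler_wpM2l (ltW eps0) gw; lra.
Qed.

(** The residual is bounded by the decrease of the model in one more step,
    which the estimate sequence bounds in turn. *)
Lemma cg_rate J kappa :
  0 < eps -> 1 <= kappa -> (0 < J)%N ->
  (forall i, (i <= J)%N -> 0 < dot (p i) (B *m p i)) ->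
  (forall i, (i <= J)%N -> dot (r i) (B *m r i) <= kappa * eps * dot (r i) (r i)) ->
  (forall i, (i < J)%N ->
     eps * dot (y J.+1 - y i) (y J.+1 - y i)
       <= dot (y J.+1 - y i) (B *m (y J.+1 - y i))) ->
  dot (r J) (r J) <= 2 * kappa * (1 - (Num.sqrt kappa)^-1) ^+ J * dot g g.
Proof.
move=> eps0 k1 J0 p_pos rL wcurv.
have k0 : 0 < kappa by lra.
have ke : 0 < kappa * eps by rewrite mulr_gt0.
have dec := cg_model_decrease J (kappa * eps) p_pos ke (rL J (leqnn J)).
have est := cg_estimate_sequence J kappa (y J.+1) eps0 k1
  (fun i iJ => p_pos i (ltnW iJ)) (fun i iJ => rL i (ltnW iJ)) wcurv.
have w0 : eps * dot (y J.+1) (y J.+1) <= dot (y J.+1) (B *m y J.+1).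
  by have := wcurv 0 J0; rewrite -[y 0]/(0 : 'cV[R]_n) subr0.
have opt := cg_optimal_bound J eps0 p_pos w0.
have c0 : 0 <= (1 - (Num.sqrt kappa)^-1) ^+ J.
  have s1 : 1 <= Num.sqrt kappa by rewrite -sqrtr1 ler_sqrt ?ltr01// ltW.
  by rewrite exprn_ge0// subr_ge0 invf_le1//; lra.
set c := _ ^+ J in est c0 *.
have copt := ler_wpM2l c0 opt.
have : dot (r J) (r J) / (2 * (kappa * eps)) <= c * (dot g g / eps) by lra.
rewrite ler_pdivrMr ?mulr_gt0//.
rewrite (_ : c * _ * _ = 2 * kappa * c * dot g g)//.
by field; rewrite gt_eqF.
Qed.

End ConjugateGradient.

Section CappedConjugateGradient.
Context {R : realType} {n : nat}.
Variables (H : 'M[R]_n) (g : 'cV[R]_n) (eps zeta M0 : R).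
Hypothesis symH : H^T = H.
Hypothesis eps_gt0 : 0 < eps.
Hypothesis zeta01 : 0 < zeta < 1.
Hypothesis M0_ge0 : 0 <= M0.
Hypothesis g_neq0 : g != 0.

Local Notation B := (damped H eps).
Local Notation y j := (cg_y (cg_iter H g eps j)).
Local Notation r j := (cg_r (cg_iter H g eps j)).
Local Notation p j := (cg_p (cg_iter H g eps j)).
Local Notation M j := (cg_bound H g eps M0 j).
Local Notation kappa j := (cg_kappa eps (M j)).
Local Notation low u := (low_curvature H eps u).
Local Notation stops := (cg_stops H g eps zeta M0).

Lemma le_update_bound (K : R) (u : 'cV[R]_n) : K <= update_bound H K u.
Proof.
rewrite /update_bound; case: ifP => // KHu.
have u0 : 0 < enorm u.
  rewrite enorm_gt0; apply: contraTneq KHu => ->.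
  by rewrite mulmx0 enorm0 mulr0 ltxx.
by rewrite ler_pdivlMr// ltW.
Qed.

Lemma update_boundP (K : R) (u : 'cV[R]_n) : enorm (H *m u) <= update_bound H K u * enorm u.
Proof.
rewrite /update_bound; case: ltP => // KHu.
have [->|u0] := eqVneq u 0; first by rewrite mulmx0 enorm0 mulr0.
by rewrite divfK// enorm_eq0.
Qed.

Lemma cg_bound_mono i j : (i <= j)%N -> M i <= M j.
Proof.
elim: j => [|j IH]; first by rewrite leqn0 => /eqP ->.
rewrite leq_eqVlt => /predU1P[->//|/IH ij].
by apply: le_trans ij _; do 3!apply: le_trans (le_update_bound _ _) => //=.
Qed.

Lemma cg_bound_ge0 j : 0 <= M j.
Proof.
apply: le_trans (cg_bound_mono 0 j _) => //.
exact: le_trans M0_ge0 (le_update_bound _ _).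
Qed.

(** Updating M with each residual makes it a bound of H on all residuals so
    far, without any knowledge of the norm of H. *)
Lemma cg_bound_residual i j : (i <= j)%N -> enorm (H *m r i) <= M j * enorm (r i).
Proof.
move=> /cg_bound_mono ij.
apply: le_trans (_ : M i * enorm (r i) <= _); last first.
  by rewrite ler_wpM2r ?enorm_ge0.
case: i {ij} => [|i]; last exact: update_boundP.
by rewrite cg_r0 mulmxN (enormN (_ *m p 0)) (enormN (p 0)); exact: update_boundP.
Qed.

Lemma cg_bound_iterate j : enorm (H *m y j) <= M j * enorm (y j).
Proof.
case: j => [|j]; first by rewrite mulmx0 enorm0 mulr0.
apply: le_trans (update_boundP _ _) _; rewrite ler_wpM2r ?enorm_ge0//.
exact: le_update_bound.
Qed.

Lemma damped_mulmx (u : 'cV[R]_n) : B *m u = H *m u + (2 * eps) *: u.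
Proof. by rewrite mulmxDl mul_scalar_mx. Qed.

Lemma not_low_curvature (u : 'cV[R]_n) : ~~ low u -> eps * dot u u <= dot u (B *m u).
Proof. by rewrite -leNgt enorm_sq. Qed.

Lemma cg_kappa_mul j : kappa j * eps = M j + 2 * eps.
Proof. by rewrite divfK// gt_eqF. Qed.

Lemma cg_kappa_ge2 j : 2 <= kappa j.
Proof. by rewrite ler_pdivlMr//; have := cg_bound_ge0 j; lra. Qed.

Lemma cg_curvature_le i j : (i <= j)%N ->
  dot (r i) (B *m r i) <= kappa j * eps * dot (r i) (r i).
Proof.
move=> ij; rewrite cg_kappa_mul damped_mulmx dotDr dotZr (mulrDl (M j)) lerD2r.
apply: le_trans (dot_le _ _) _; rewrite -enorm_sq.
have := ler_wpM2l (enorm_ge0 (r i)) (cg_bound_residual i j ij).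
by rewrite mulrCA -expr2.
Qed.

Lemma cg_positive_curvature J :
  (forall i, (i < J)%N -> r i != 0 /\ ~~ low (p i)) ->
  forall i, (i < J)%N -> 0 < dot (p i) (B *m p i).
Proof.
move=> run i; elim/ltn_ind: i => i IH iJ.
have [ri0 pi] := run i iJ.
have p_pos k : (k < i)%N -> 0 < dot (p k) (B *m p k).
  by move=> ki; apply: IH => //; exact: ltn_trans iJ.
have [_ _ rp] := cg_conjugacy H g eps symH i p_pos i (leqnn i).
apply: lt_le_trans (not_low_curvature _ pi).
rewrite mulr_gt0// dot_gt0; apply: contra_neq ri0 => pi0.
by apply/eqP; rewrite -dot_eq0 -oppr_eq0 -rp pi0 dot0r.
Qed.

Lemma cg_zeta_hat_bound j : 0 < cg_zeta_hat eps zeta (M j).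
Proof.
have k2 := cg_kappa_ge2 j; case/andP: zeta01 => z0 _.
by rewrite divr_gt0//; lra.
Qed.

Lemma not_stops_curvature J : ~~ low (p 0) ->
  (forall i, (0 < i < J)%N -> ~~ stops i) ->
  forall i, (i < J)%N -> r i != 0 /\ ~~ low (p i).
Proof.
move=> p0 run [|i] iJ; first by split.
have := run i.+1; rewrite iJ => /(_ isT).
rewrite !negb_or => /and4P[_ small pi _]; split=> //.
apply: contraNneq small => ri0; rewrite /small_residual ri0 enorm0.
by rewrite mulr_ge0 ?enorm_ge0// ltW// cg_zeta_hat_bound.
Qed.

Lemma cg_tau_bounds (K : R) : 0 <= K -> 0 < cg_tau eps K < 1.
Proof.
move=> K0; have e2 : 0 < 2 * eps by rewrite mulr_gt0.
have k0 : 0 < cg_kappa eps K by rewrite divr_gt0// ltr_wpDl.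
have := k0; rewrite -sqrtr_gt0 => s0.
by rewrite divr_gt0 ?ltr_pdivrMr; lra.
Qed.

(** The left-hand side is the bound of cg_rate. It is dominated because
    2 kappa <= 4 kappa ^ 4 <= T and 1 - 1 / sqrt kappa <= tau. *)
Lemma cg_threshold_ge J (K : R) (c := cg_kappa eps K) : 0 <= K ->
  2 * c * (1 - (Num.sqrt c)^-1) ^+ J
    <= (Num.sqrt (cg_T eps K) * cg_tau eps K `^ (J%:R / 2)) ^+ 2.
Proof.
move=> K0; have c2 : 2 <= c by rewrite ler_pdivlMr//; lra.
have /andP[t0 t1] := cg_tau_bounds K K0.
have s1 : 1 <= Num.sqrt c by rewrite -sqrtr1 ler_sqrt; lra.
have st1 : 0 < 1 - Num.sqrt (cg_tau eps K) <= 1.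
  rewrite subr_gt0 -{1}sqrtr1 ltr_sqrt// t1 /=.
  by have := sqrtr_ge0 (cg_tau eps K); lra.
case/andP: st1 => st0 st1.
have T_ge : 4 * c ^+ 4 <= cg_T eps K.
  rewrite /cg_T -/c ler_pdivlMr ?exprn_gt0//.
  have : 0 <= c ^+ 4 by rewrite exprn_ge0//; lra.
  have : (1 - Num.sqrt (cg_tau eps K)) ^+ 2 <= 1 by rewrite expr_le1// ltW.
  by nra.
have c4 : c <= c ^+ 4 by rewrite -{1}(expr1 c) ler_eXn2l//; lra.
rewrite exprMn sqr_sqrtr; last by lra.
have -> : (cg_tau eps K `^ (J%:R / 2)) ^+ 2 = cg_tau eps K ^+ J.
  by rewrite -powR_mulrn ?powR_ge0// -powRrM divfK// powR_mulrn// ltW.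
apply: ler_pM.
- by lra.
- by rewrite exprn_ge0// subr_ge0 invf_le1//; lra.
- by lra.
- apply: lerXn2r; rewrite ?nnegrE ?(ltW t0)//.
    by rewrite subr_ge0 invf_le1//; lra.
  rewrite /cg_tau -/c ler_pdivlMr; last by lra.
  rewrite -(ler_pM2r (_ : 0 < Num.sqrt c)); last by lra.
  rewrite (_ : (1 - _) * _ * _ = Num.sqrt c ^+ 2 - 1); last first.
    by field; rewrite gt_eqF//; lra.
  lra.
Qed.

(** Without a direction of low curvature towards y J.+1, the bound of cg_rate
    holds, and it contradicts the slow decrease of the residual. *)
Lemma slow_residual_negative_curvature J : ~~ low (p 0) -> (0 < J)%N ->
  (forall i, (0 < i < J)%N -> ~~ stops i) ->
  r J != 0 -> ~~ low (p J) -> slow_residual H g eps M0 J ->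
  exists2 i, (i < J)%N & low (y J.+1 - y i).
Proof.
move=> p0 J0 run rJ pJ slow; apply: contrapT => no_low.
have all_curv i : (i <= J)%N -> r i != 0 /\ ~~ low (p i).
  by rewrite leq_eqVlt => /predU1P[->//|]; exact: not_stops_curvature.
have p_pos i : (i <= J)%N -> 0 < dot (p i) (B *m p i).
  exact: (cg_positive_curvature J.+1 all_curv).
have k2 := cg_kappa_ge2 J.
have k1 : 1 <= kappa J by lra.
have := cg_rate H g eps symH J (kappa J) eps_gt0 k1 J0 p_pos.
move=> /(_ (fun i iJ => cg_curvature_le i J iJ)) rate.
have {}rate : dot (r J) (r J)
    <= 2 * kappa J * (1 - (Num.sqrt (kappa J))^-1) ^+ J * dot g g.
  apply: rate => i iJ; apply: not_low_curvature.
  by apply/negP => lowi; apply: no_low; exists i.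
have thr := cg_threshold_ge J (M J) (cg_bound_ge0 J).
move: slow; rewrite /slow_residual.
set s := Num.sqrt _ * _ in thr *.
have s0 : 0 <= s by rewrite mulr_ge0 ?sqrtr_ge0 ?powR_ge0.
apply/negP; rewrite -leNgt -ler_sqr ?nnegrE; last 2 first.
- exact: enorm_ge0.
- exact/mulr_ge0/enorm_ge0.
rewrite exprMn !enorm_sq.
by apply: le_trans rate _; rewrite ler_wpM2r ?dot_ge0.
Qed.

(** The residuals are nonzero and orthogonal until the method stops, so it
    stops after at most n steps. *)
Lemma cg_eventually_stops : ~~ low (p 0) -> exists j, (0 < j)%N && stops j.
Proof.
move=> p0; apply: contrapT => no_stop.
have run i : (0 < i < n.+1)%N -> ~~ stops i.
  by case/andP => i0 _; apply/negP => si; apply: no_stop; exists i; rewrite i0.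
have curv := not_stops_curvature n.+1 p0 run.
have p_pos := cg_positive_curvature n.+1 curv.
suff : (n.+1 <= n)%N by rewrite ltnn.
apply: (orthogonal_family_small _ (fun i => r i)) => [i /curv[]//|i j /andP[ij jn]].
apply: (cg_residuals_orthogonal H g eps symH n.+1 p_pos).
by rewrite ij ltnW.
Qed.

Lemma capped_cg_exists : exists out, capped_cg H g eps zeta M0 out.
Proof.
rewrite /capped_cg; have [_|/negPf p0] := boolP (low (p 0)); first by eexists.
have [|j /andP[j0 sj] jmin] := ex_minnP (cg_eventually_stops _).
  by rewrite p0.
have run i : (0 < i < j)%N -> ~~ stops i.
  case/andP => i0 ij; apply/negP => si.
  by have := jmin i; rewrite i0 si leqNgt ij => /(_ isT).
suff [out outP] : exists out, cg_returns H g eps zeta M0 j out.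
  by exists out, j.
rewrite /cg_returns; move: sj; rewrite /cg_stops.
have [_ _|_] := boolP (low (y j)); first by eexists.
have [_ _|small] := boolP (small_residual H g eps zeta M0 j); first by eexists.
have [_ _|pj slow] := boolP (low (p j)); first by eexists.
have rj : r j != 0.
  apply: contraNneq small => rj0; rewrite /small_residual rj0 enorm0.
  by rewrite mulr_ge0 ?enorm_ge0// ltW// cg_zeta_hat_bound.
have [|i ij lowi] := slow_residual_negative_curvature j _ j0 run rj pj slow.
  by rewrite p0.
by exists (y j.+1 - y i, NC); split=> //; exists i.
Qed.

Lemma capped_cg_NC d : capped_cg H g eps zeta M0 (d, NC) -> low d.
Proof.
rewrite /capped_cg; case: ifP => [p0 [->]//|_ [j [_ _]]].
rewrite /cg_returns; case: ifP => [yj [->]//|_]; case: ifP => // _.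
by case: ifP => [pj [->]//|_ [_ [i [_ ? [->]]]]].
Qed.

(** The first clause is the orthogonality of the residual to the iterate. The
    test bounds the residual by the norm of g; as M bounds H at the iterate
    too, norm g is at most of the order kappa eps norm d, and the factor 1 / kappa
    in the accuracy turns the test into a bound by the norm of d. *)
Lemma capped_cg_SOL d : capped_cg H g eps zeta M0 (d, SOL) ->
  [/\ dot g d = - dot d (B *m d), eps * dot d d <= dot d (B *m d),
      d != 0 & enorm (g + B *m d) <= zeta / 2 * eps * enorm d].
Proof.
rewrite /capped_cg; case: ifP => // /negbT p0 [j [j0 run]].
rewrite /cg_returns; case: ifPn => // yj.
case: ifP => [small [->]|_]; last by case: ifP => // _ [_ [i []]].
have curv := not_stops_curvature j p0 run.
have p_pos := cg_positive_curvature j curv.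
have gy : dot g (y j) = - dot (y j) (B *m y j).
  apply/eqP; rewrite -addr_eq0 (dotC (y j)) -dotDl -cg_residual.
  by rewrite (cg_residual_iterate H g eps symH j p_pos) ?leqnn.
have k2 := cg_kappa_ge2 j; case/andP: zeta01 => z0 z1.
move: small; rewrite /small_residual -[r 0]/g cg_residual => small.
have By : enorm (B *m y j) <= kappa j * eps * enorm (y j).
  rewrite damped_mulmx cg_kappa_mul (mulrDl (M j)).
  apply: le_trans (enormD _ _) _; apply: lerD; first exact: cg_bound_iterate.
  by rewrite enormZ ger0_norm// mulr_ge0// ltW.
have g_le : enorm g <= enorm (g + B *m y j) + enorm (B *m y j).
  by rewrite -[X in enorm X <= _](addrK (B *m y j)) -(enormN (B *m y j)); exact: enormD.
(* the accuracy is at most 1/6, hence norm g is at most 6/5 kappa eps norm y *)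
have zh : 0 < cg_zeta_hat eps zeta (M j) <= 1 / 6.
  by rewrite cg_zeta_hat_bound /= ler_pdivrMr; nra.
case/andP: zh => zh0 zh1.
have gn := enorm_ge0 g.
have g_small : enorm g <= 6 / 5 * (kappa j * eps * enorm (y j)) by nra.
split=> //.
- exact: not_low_curvature.
- apply: contraNneq g_neq0 => y0; rewrite -enorm_eq0; apply/eqP/le_anti.
  by rewrite gn andbT (le_trans g_small)// y0 enorm0; lra.
- apply: le_trans small _.
  apply: le_trans (ler_wpM2l (ltW zh0) g_small) _.
  rewrite (_ : cg_zeta_hat _ _ _ * _ = 2 / 5 * (zeta * eps * enorm (y j))).
    have : 0 <= zeta * eps * enorm (y j) by rewrite !mulr_ge0 ?enorm_ge0// ltW.
    lra.
  by rewrite /cg_zeta_hat; field; rewrite gt_eqF//; lra.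
Qed.

End CappedConjugateGradient.

(** * Taylor bounds *)

Section DirectionalDerivatives.
Context {R : realType} {n : nat}.
Implicit Types (x u d : 'cV[R]_n) (h f : 'cV[R]_n -> R).

Lemma derive_coordinates h x d : differentiable h x ->
  'D_d h x = \sum_i 'D_(delta_mx i 0) h x * d i 0.
Proof.
move=> dh; rewrite deriveE// [X in 'd h x X](matrix_sum_delta d) linear_sum.
by apply: eq_bigr => i _; rewrite big_ord1 linearZ /= mulrC deriveE.
Qed.

Lemma derive_gradient f x d : differentiable f x ->
  'D_d f x = dot (gradient f x) d.
Proof.
by move=> df; rewrite derive_coordinates//; apply: eq_bigr => i _; rewrite mxE.
Qed.

Lemma is_derive_hessian f x u d : differentiable (gradient f) x ->
  is_derive x d (fun z => dot (gradient f z) u) (dot u (hessian f x *m d)).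
Proof.
move=> dg.
have dgi i : differentiable (fun z => gradient f z i 0) x.
  exact: (differentiable_comp dg (differentiable_coord _ _ _)).
have -> : (fun z => dot (gradient f z) u)
    = \sum_(i < n) (u i 0 *: (fun z => gradient f z i 0)).
  apply/funext => z; rewrite fct_sumE; apply: eq_bigr => i _.
  by rewrite mulrC.
have di i : is_derive x d (u i 0 *: (fun z => gradient f z i 0))
    (u i 0 *: (hessian f x *m d) i 0).
  apply: is_deriveZ; apply: DeriveDef; first exact: diff_derivable.
  rewrite derive_coordinates// mxE; apply: eq_bigr => j _.
  by rewrite mxE.
exact: is_derive_sum.
Qed.

Lemma is_derive_line h x d t df : is_derive (x + t *: d) d h df ->
  is_derive (t : R) 1 (fun s => h (x + s *: d)) df.
Proof.
case=> dh <-.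
have E : (fun k : R => k^-1 *: (((fun s => h (x + s *: d)) \o shift t) (k *: 1)
      - h (x + t *: d)))
    = (fun k => k^-1 *: ((h \o shift (x + t *: d)) (k *: d) - h (x + t *: d))).
  apply/funext => k /=; rewrite /shift /= [_ *: 1]mulr1 scalerDl.
  by rewrite addrCA.
by apply: DeriveDef; rewrite /derivable /derive E.
Qed.

End DirectionalDerivatives.

Lemma derive_le_increment {R : realType} (f p df dp : R -> R) (T : R) : 0 <= T ->
  (forall t, 0 <= t <= T -> is_derive t 1 f (df t)) ->
  (forall t, 0 <= t <= T -> is_derive t 1 p (dp t)) ->
  (forall t, 0 <= t <= T -> df t <= dp t) ->
  f T - f 0 <= p T - p 0.
Proof.
move=> T0 Df Dp le_d.
have D t : 0 <= t <= T -> is_derive t 1 (p \- f) (dp t - df t).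
  by move=> t0T; apply: is_deriveB; [exact: Dp | exact: Df].
have [t||c] := @MVT_segment _ (p \- f) (fun t => dp t - df t) 0 T T0.
- by rewrite in_itv /= => /andP[/ltW t0 /ltW tT]; apply: D; rewrite t0.
- apply: derivable_within_continuous => t; rewrite in_itv /= => /D.
  by case.
rewrite in_itv /= => /le_d le_c; rewrite subr0 /= => E.
have : 0 <= (dp c - df c) * T by rewrite mulr_ge0// subr_ge0.
by rewrite -E; lra.
Qed.

(** Comparison with a quadratic polynomial for the derivative, then with a cubic
    one for the function. *)
Lemma taylor2_le {R : realType} (f df ddf : R -> R) (T a K : R) : 0 <= T ->
  (forall t, 0 <= t <= T -> is_derive t 1 f (df t)) ->
  (forall t, 0 <= t <= T -> is_derive t 1 df (ddf t)) ->
  (forall t, 0 <= t <= T -> ddf t <= a + K * t) ->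
  f T <= f 0 + df 0 * T + a / 2 * T ^+ 2 + K / 6 * T ^+ 3.
Proof.
move=> T0 Df Ddf le_dd.
have le_df t : 0 <= t <= T -> df t <= df 0 + a * t + K / 2 * t ^+ 2.
  case/andP => t0 tT.
  have := @derive_le_increment R df (fun s => a * s + K / 2 * s ^+ 2) ddf
    (fun s => a + K * s) t t0.
  rewrite expr0n /= !mulr0 => H; suff: df t - df 0 <= a * t + K / 2 * t ^+ 2 - (0 + 0).
    by lra.
  apply: H => s /andP[s0 st].
  - by apply: Ddf; rewrite s0 (le_trans st).
  - by apply: is_derive_eq; rewrite /GRing.scale /= /GRing.scale /=; field.
  - by apply: le_dd; rewrite s0 (le_trans st).
have := @derive_le_increment R f
  (fun s => df 0 * s + a / 2 * s ^+ 2 + K / 6 * s ^+ 3) df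
  (fun s => df 0 + a * s + K / 2 * s ^+ 2) T T0 Df.
rewrite !expr0n /= !mulr0 => H.
suff: f T - f 0 <= df 0 * T + a / 2 * T ^+ 2 + K / 6 * T ^+ 3 - (0 + 0 + 0) by lra.
apply: H => // s _.
by apply: is_derive_eq; rewrite /GRing.scale /= /GRing.scale /=; field.
Qed.

Section TaylorBounds.
Context {R : realType} {n : nat}.
Variables (f : 'cV[R]_n -> R) (U : set 'cV[R]_n) (L : R).
Hypothesis f_diff2 : twice_differentiable_on U f.
Hypothesis hess_lip : hessian_lipschitz_on U L f.

Implicit Types (x d u v : 'cV[R]_n) (t : R).

Local Notation g := (gradient f).
Local Notation H := (hessian f).

Definition segment_in x d := forall t : R, 0 <= t <= 1 -> U (x + t *: d).

Lemma segment_in_start x d : segment_in x d -> U x.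
Proof. by move=> /(_ 0); rewrite scale0r addr0 lexx ler01; exact. Qed.

Lemma hessian_line_bound x d u t : segment_in x d -> 0 <= t <= 1 ->
  `|dot u (H (x + t *: d) *m d) - dot u (H x *m d)|
    <= L * enorm d ^+ 2 * enorm u * t.
Proof.
move=> Ud t01; rewrite -dotNr -dotDr -mulmxBl.
apply: le_trans (dot_mulmx_le _ _ _) _.
have := hess_lip _ _ (Ud t t01) (segment_in_start _ _ Ud).
rewrite (_ : x + t *: d - x = t *: d); last by rewrite addrC addKr.
rewrite enormZ ger0_norm; last by case/andP: t01.
move=> lip; rewrite -mulrA (_ : L * _ * _ * _ = L * (t * enorm d) * (enorm u * enorm d)).
  by apply: ler_wpM2r => //; rewrite mulr_ge0 ?enorm_ge0.
by ring.
Qed.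

Lemma gradient_line_derive x d u t : segment_in x d -> 0 <= t <= 1 ->
  is_derive t 1 (fun s => dot (g (x + s *: d)) u) (dot u (H (x + t *: d) *m d)).
Proof.
move=> Ud t01; apply: (is_derive_line (fun z => dot (g z) u)).
by apply: is_derive_hessian; have [] := f_diff2 _ (Ud t t01).
Qed.

Lemma line_derive x d t : segment_in x d -> 0 <= t <= 1 ->
  is_derive t 1 (fun s => f (x + s *: d)) (dot (g (x + t *: d)) d).
Proof.
move=> Ud t01; apply: is_derive_line; have [df _] := f_diff2 _ (Ud t t01).
by apply: DeriveDef; [exact: diff_derivable | exact: derive_gradient].
Qed.

Lemma taylor_cubic x d : segment_in x d ->
  f (x + d) <= f x + dot (g x) d + dot d (H x *m d) / 2 + L / 6 * enorm d ^+ 3.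
Proof.
move=> Ud.
have := @taylor2_le R (fun s => f (x + s *: d)) (fun s => dot (g (x + s *: d)) d)
  (fun s => dot d (H (x + s *: d) *m d)) 1 (dot d (H x *m d)) (L * enorm d ^+ 3)
  ler01 (fun t => line_derive x d t Ud) (fun t => gradient_line_derive x d d t Ud).
rewrite !scale1r !scale0r !addr0 !expr1n !mulr1 => T; rewrite [L / 6 * _]mulrAC.
apply: T => t t01; rewrite -lerBlDl; apply: le_trans (ler_norm _) _.
by rewrite exprSr mulrA; exact: hessian_line_bound.
Qed.

Lemma gradient_quadratic_dot x d u : segment_in x d ->
  dot (g (x + d) - g x - H x *m d) u <= L / 2 * enorm d ^+ 2 * enorm u.
Proof.
move=> Ud; set K := L * enorm d ^+ 2 * enorm u.
have := @derive_le_increment R (fun s => dot (g (x + s *: d)) u)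
  (fun s => dot u (H x *m d) * s + K / 2 * s ^+ 2)
  (fun s => dot u (H (x + s *: d) *m d)) (fun s => dot u (H x *m d) + K * s) 1
  ler01 (fun t => gradient_line_derive x d u t Ud).
rewrite scale1r scale0r addr0 expr1n expr0n /= !mulr0 !mulr1 => T.
suff: dot (g (x + d)) u - dot (g x) u <= dot u (H x *m d) + K / 2 - (0 + 0).
  by rewrite !dot_linear (dotC (_ *m _)) /K; lra.
apply: T => t t01.
  by apply: is_derive_eq; rewrite /GRing.scale /= /GRing.scale /=; field.
by rewrite -lerBlDl; apply: le_trans (ler_norm _) _; exact: hessian_line_bound.
Qed.

(** The bound is tested against the error vector itself. *)
Lemma taylor_gradient x d : segment_in x d ->
  enorm (g (x + d) - g x - H x *m d) <= L / 2 * enorm d ^+ 2.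
Proof.
move=> Ud; set e := _ - _ *m d.
have := gradient_quadratic_dot x d e Ud; rewrite -/e -enorm_sq expr2.
have [->|e0] := eqVneq e 0; last by rewrite ler_pM2r// enorm_gt0.
move=> _; rewrite enorm0.
have := hessian_line_bound x d d 1 Ud; rewrite ler01 lexx => /(_ isT).
have [->|d0] := eqVneq d 0; first by rewrite enorm0 expr0n /= !mulr0.
move/(le_trans (normr_ge0 _)); rewrite mulr1 pmulr_lge0 ?enorm_gt0//.
by rewrite pmulr_lge0 ?exprn_gt0 ?enorm_gt0// => L0; rewrite mulr_ge0 ?exprn_ge0 ?enorm_ge0//; lra.
Qed.

End TaylorBounds.

(** The entries of a vector are at most its Euclidean norm, so Euclidean balls
    are contained in those of the maximum norm. *)
Lemma open_enorm_ball {R : realType} {n : nat} (U : set 'cV[R]_n) x :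
  open U -> U x -> exists2 e : R, 0 < e & forall d, enorm d < e -> U (x + d).
Proof.
move=> oU Ux; have /nbhs_ballP[e /= e0 eU] := open_nbhs_nbhs (conj oU Ux).
exists e => // d de; apply: eU.
rewrite -ball_normE /= opprD addNKr normrN.
rewrite [ltLHS]/Num.Def.normr /= mx_normrE; apply/bigmax_ltP; split=> //= -[i j] _.
rewrite /= ord1; apply: le_lt_trans de; rewrite -sqrtr_sqr ler_wsqrtr//.
rewrite /dot (bigD1 i)//= -expr2 lerDl sumr_ge0// => k _.
by rewrite -expr2 sqr_ge0.
Qed.

Section HessianSymmetric.
Context {R : realType} {n : nat}.
Variables (f : 'cV[R]_n -> R) (U : set 'cV[R]_n) (L : R).
Hypothesis U_open : open U.
Hypothesis f_diff2 : twice_differentiable_on U f.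
Hypothesis hess_lip : hessian_lipschitz_on U L f.

Implicit Types (x d u v : 'cV[R]_n) (e t : R).

Let second_difference x u v :=
  f (x + u + v) - f (x + u) - f (x + v) + f x.

(* The mean value theorem along u reduces the second difference to a
   difference of gradients, which taylor_gradient linearizes at x. *)
Let second_difference_bound x e u v : 0 <= L ->
  (forall d, enorm d < e -> U (x + d)) -> enorm u + enorm v < e ->
  `|second_difference x u v - dot u (hessian f x *m v)|
    <= L * (enorm u + enorm v) ^+ 3.
Proof.
move=> L0 ball uv.
have u0 := enorm_ge0 u; have v0 := enorm_ge0 v.
have small s a : 0 <= s <= 1 -> 0 <= a <= 1 -> enorm (s *: u + a *: v) < e.
  case/andP=> s0 s1 /andP[a0 a1]; apply: le_lt_trans uv.
  apply: le_trans (enormD _ _) _; rewrite !enormZ !ger0_norm//.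
  by apply: lerD; apply: ler_piMl.
have seg s a : 0 <= s <= 1 -> 0 <= a <= 1 -> segment_in U x (s *: u + a *: v).
  move=> s01 a01 t t01; apply: ball; apply: le_lt_trans (small s a s01 a01).
  by rewrite enormZ ger0_norm; case/andP: t01 => // t0 t1; rewrite ler_piMl ?enorm_ge0.
have u_seg a : 0 <= a <= 1 -> segment_in U (x + a *: v) u.
  move=> a01 t t01; rewrite -addrA (addrC (a *: v)).
  by apply: ball; exact: small.
have D0 t : 0 <= t <= 1 -> is_derive t 1 (fun s => f (x + s *: u + v) - f (x + s *: u))
    (dot (gradient f (x + t *: u + v)) u - dot (gradient f (x + t *: u)) u).
  move=> t01; apply: is_deriveB; last first.
    have := u_seg 0; rewrite scale0r addr0 lexx ler01 => /(_ isT) seg0.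
    exact: (line_derive f U f_diff2).
  have := u_seg 1; rewrite scale1r lexx ler01 => /(_ isT) seg1.
  have := line_derive f U f_diff2 (x + v) u t seg1 t01.
  rewrite (_ : (fun s => f (x + v + s *: u)) = (fun s => f (x + s *: u + v))).
    by rewrite addrAC.
  by apply/funext => s; rewrite addrAC.
have [t||c] := @MVT_segment _ (fun s => f (x + s *: u + v) - f (x + s *: u))
  (fun t => dot (gradient f (x + t *: u + v)) u - dot (gradient f (x + t *: u)) u)
  0 1 ler01.
- by rewrite in_itv /= => /andP[/ltW t0 /ltW t1]; apply: D0; rewrite t0.
- by apply: derivable_within_continuous => t; rewrite in_itv /= => /D0[].
rewrite in_itv /= subr0 mulr1 !scale1r !scale0r !addr0 => c01 E.
have {}E : second_difference x u v
    = dot (gradient f (x + c *: u + v)) u - dot (gradient f (x + c *: u)) u.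
  by rewrite -E /second_difference; ring.
have one01 : 0 <= (1 : R) <= 1 by rewrite ler01 lexx.
have zero01 : 0 <= (0 : R) <= 1 by rewrite ler01 lexx.
have := taylor_gradient f U L f_diff2 hess_lip _ _ (seg c 1 c01 one01).
have := taylor_gradient f U L f_diff2 hess_lip _ _ (seg c 0 c01 zero01).
rewrite scale0r scale1r addr0 addrA.
set a := _ - _ *m _ => a_le; set b := _ - _ *m _ => b_le.
have -> : second_difference x u v - dot u (hessian f x *m v) = dot u (b - a).
  by rewrite E /a /b !mulmxDr !dot_linear !(dotC u (gradient _ _)); ring.
have ab : enorm (b - a) <= L * (enorm u + enorm v) ^+ 2.
  apply: le_trans (enormD _ _) _; rewrite enormN.
  have c_le : enorm (c *: u) <= enorm u + enorm v.
    by rewrite enormZ ger0_norm; case/andP: c01 => // c0 c1; nra.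
  have cv_le : enorm (c *: u + v) <= enorm u + enorm v.
    apply: le_trans (enormD _ _) _; rewrite lerD2r enormZ ger0_norm.
      by case/andP: c01 => // c0 c1; nra.
    by case/andP: c01.
  have sq (z : 'cV[R]_n) : enorm z <= enorm u + enorm v ->
      L / 2 * enorm z ^+ 2 <= L / 2 * (enorm u + enorm v) ^+ 2.
    move=> z_le; apply: ler_wpM2l; first by lra.
    by apply: lerXn2r => //; rewrite nnegrE ?enorm_ge0 ?addr_ge0.
  by have := sq _ c_le; have := sq _ cv_le; lra.
apply: le_trans (cauchy_schwarz _ _) _.
have sq0 : 0 <= L * (enorm u + enorm v) ^+ 2 by rewrite mulr_ge0 ?exprn_ge0 ?addr_ge0.
rewrite exprSr mulrA mulrC; apply: ler_pM => //; first exact: enorm_ge0.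
by rewrite lerDl.
Qed.

(** The symmetry of second_difference in u and v gives the one of the Hessian:
    by second_difference_bound, the second difference along t u and t v is
    t^2 (u . H v) as well as t^2 (v . H u), up to an error of order t^3. *)
Lemma hessian_sym x : 0 <= L -> U x -> (hessian f x)^T = hessian f x.
Proof.
move=> L0 Ux; have [e e0 ball] := open_enorm_ball U x U_open Ux.
suff sym u v : dot u (hessian f x *m v) = dot v (hessian f x *m u).
  apply/matrixP => i j; rewrite mxE.
  have entry (A : 'M[R]_n) k l : dot (delta_mx k 0) (A *m delta_mx l 0) = A k l.
    rewrite /dot (bigD1 k)//= big1 => [|m mk].
      by rewrite -colE !mxE !eqxx mul1r addr0.
    by rewrite mxE (negPf mk) mul0r.
  by rewrite -!entry sym.
pose N := enorm u + enorm v.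
have N0 : 0 <= N by rewrite addr_ge0 ?enorm_ge0.
set D := dot u _; set D' := dot v _.
have bound t : 0 < t -> t * N < e -> `|D - D'| <= 2 * L * N ^+ 3 * t.
  move=> t0 tN.
  have tuv : enorm (t *: u) + enorm (t *: v) = t * N.
    by rewrite !enormZ gtr0_norm// -mulrDr.
  have := second_difference_bound x e (t *: u) (t *: v) L0 ball.
  have := second_difference_bound x e (t *: v) (t *: u) L0 ball.
  rewrite (addrC (enorm (t *: v))) tuv => /(_ tN) B1 /(_ tN) B2.
  have sd : second_difference x (t *: v) (t *: u) = second_difference x (t *: u) (t *: v).
    by rewrite /second_difference (addrAC x); ring.
  move: B1 B2; rewrite sd -!scalemxAr !dot_linear -/D -/D'.
  set S := second_difference _ _ _ => B1 B2.
  have : t ^+ 2 * `|D - D'| <= t ^+ 2 * (2 * L * N ^+ 3 * t).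
    rewrite -{1}(ger0_norm (sqr_ge0 t)) -normrM.
    rewrite (_ : t ^+ 2 * (D - D') = (S - t * (t * D')) - (S - t * (t * D))); last ring.
    apply: le_trans (ler_normB _ _) _; rewrite exprMn in B1 B2.
    by have := lerD B1 B2; lra.
  by rewrite ler_pM2l// exprn_gt0.
apply/eqP; rewrite -subr_eq0 -normr_le0 leNgt; apply/negP => D0.
pose C := 2 * L * N ^+ 3 + 1.
have C1 : 1 <= C by rewrite lerDr !mulr_ge0 ?exprn_ge0.
pose t := Num.min (e / 2 / (N + 1)) (`|D - D'| / 2 / C).
have t0 : 0 < t by rewrite lt_min !divr_gt0//; lra.
have tN : t * N < e.
  have : t * (N + 1) <= e / 2 by rewrite -ler_pdivlMr ?ge_min ?lexx//; lra.
  by rewrite mulrDr mulr1; lra.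
have t2 : t * C <= `|D - D'| / 2.
  by rewrite -ler_pdivlMr ?ge_min ?lexx ?orbT//; lra.
have := bound t t0 tN; move: t2; rewrite /C mulrDr mulr1; lra.
Qed.

End HessianSymmetric.

(** * First crossing of the line search curve *)

(** U contains two distinct points as soon as n > 0. *)
Lemma lipschitz_const_ge0 {R : realType} {n : nat} (f : 'cV[R]_n -> R) U (L : R) x :
  (0 < n)%N -> open U -> U x -> hessian_lipschitz_on U L f -> 0 <= L.
Proof.
case: n f U x => // n f U x _ oU Ux lip.
have [e e0 ball] := open_enorm_ball U x oU Ux.
pose d : 'cV[R]_n.+1 := (e / 2) *: delta_mx 0 0.
have dd : enorm d = e / 2.
  rewrite enormZ ger0_norm; last by lra.
  rewrite /enorm /dot (bigD1 0)//= big1 ?mxE ?eqxx ?mulr1 ?addr0 ?sqrtr1 ?mulr1//.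
  by move=> i i0; rewrite mxE (negPf i0) mul0r.
have Ud : U (x + d) by apply: ball; rewrite dd; lra.
have := le_trans (opnorm_ge0 _) (lip _ _ Ud Ux).
by rewrite addrC addKr dd pmulr_lge0//; lra.
Qed.

Section Descent.
Context {R : realType} {n : nat}.
Variables (f : 'cV[R]_n -> R) (x0 : 'cV[R]_n) (U : set 'cV[R]_n) (L eta : R).
Hypothesis U_open : open U.
Hypothesis level_compact : compact [set x : 'cV[R]_n | f x <= f x0].
Hypothesis level_sub : [set x : 'cV[R]_n | f x <= f x0] `<=` U.
Hypothesis f_diff2 : twice_differentiable_on U f.
Hypothesis hess_lip : hessian_lipschitz_on U L f.
Hypothesis eta_gt0 : 0 < eta.
Implicit Types (x d : 'cV[R]_n) (t T : R).

Local Notation g := (gradient f).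
Local Notation H := (hessian f).

Definition decreases x d t := f (x + t *: d) < f x - eta / 6 * t ^+ 3 * enorm d ^+ 3.

Definition model_decreases x d t :=
  dot (g x) d * t + dot d (H x *m d) / 2 * t ^+ 2 + L / 6 * t ^+ 3 * enorm d ^+ 3
    < - (eta / 6 * t ^+ 3 * enorm d ^+ 3).

(** The level set is closed because it is compact. *)
Lemma level_limit x d t : 0 < t ->
  (forall s, 0 <= s < t -> f (x + s *: d) <= f x0) -> f (x + t *: d) <= f x0.
Proof.
move=> t0 le_s; apply: contrapT => not_le.
have := compact_closed (@norm_hausdorff _ _) level_compact.
rewrite -openC => /open_enorm_ball /(_ not_le)[e e0 ball].
pose s := Num.min t (e / (enorm d + 1) / 2).
have dn := enorm_ge0 d.
have s0 : 0 < s by rewrite lt_min t0 !divr_gt0//; lra.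
have st : s <= t by rewrite ge_min lexx.
have := le_s (t - s); rewrite subr_ge0 st ltrBlDr ltrDl s0 => /(_ isT).
have -> : x + (t - s) *: d = (x + t *: d) + (- s) *: d by rewrite scalerDl addrA.
apply: ball; rewrite enormZ normrN gtr0_norm//.
have : s <= e / 2 / (enorm d + 1) by rewrite mulrAC ge_min lexx orbT.
by rewrite ler_pdivlMr; [nra | lra].
Qed.

(** Neighbourhoods of the level set need not contain the segments between its
    points, so the cubic Taylor bound is available at t only once the segment
    up to t is known to stay in U. Up to the first t at which the decrease
    fails, the segment lies in the level set, which is closed and inside the
    open set U; hence the bound extends slightly beyond that t. *)
Lemma model_decreases_decreases x d T : f x <= f x0 ->
  (forall t, 0 < t <= T -> model_decreases x d t) ->
  forall t, 0 < t <= T -> decreases x d t.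
Proof.
move=> x_lev model t1 t1T; apply: contrapT => bad1.
pose E := [set t | 0 < t <= T /\ ~ decreases x d t].
have E1 : E t1 by [].
have E_lb : lbound E 0 by move=> t [/andP[/ltW]].
have E_inf : has_inf E by split; [exists t1 | exists 0].
pose t0 := inf E.
have t0_lb : lbound E t0 by apply: ge_inf; exists 0.
have t0_ge0 : 0 <= t0 by apply: lb_le_inf => //; exists t1.
have t0T : t0 <= T by apply: le_trans (t0_lb _ E1) _; case/andP: t1T.
have taylor t : 0 < t <= T -> (forall s, 0 <= s <= t -> U (x + s *: d)) ->
    decreases x d t.
  move=> /[dup] /andP[tpos tT] t0T' Us.
  have seg : segment_in U x (t *: d).
    move=> s /andP[s0 s1]; rewrite scalerA; apply: Us.
    by rewrite mulr_ge0 ?(ltW tpos)//= ler_piMl// ltW.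
  have := taylor_cubic f U L f_diff2 hess_lip x (t *: d) seg.
  have := model t t0T'; rewrite /model_decreases /decreases.
  rewrite -!scalemxAr !dot_linear enormZ gtr0_norm// exprMn; lra.
have lev s : 0 <= s < t0 -> f (x + s *: d) <= f x0.
  case/andP; rewrite le_eqVlt => /predU1P[<- _|s0 st0].
    by rewrite scale0r addr0.
  have : decreases x d s.
    apply: contrapT => bad; have : t0 <= s; last by rewrite leNgt st0.
    by apply: t0_lb; split=> //; rewrite s0 ltW// (lt_le_trans st0).
  rewrite /decreases => /ltW /le_trans; apply; apply: le_trans x_lev.
  rewrite lerBlDr lerDl !mulr_ge0 ?exprn_ge0 ?enorm_ge0 ?ltW//.
have lev0 : f (x + t0 *: d) <= f x0.
  move: t0_ge0; rewrite le_eqVlt => /predU1P[<-|t0_gt0].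
    by rewrite scale0r addr0.
  exact: level_limit.
have [e e0 ball] := open_enorm_ball U _ U_open (level_sub _ lev0).
have dn := enorm_ge0 d.
pose h := e / (enorm d + 1).
have h0 : 0 < h by rewrite divr_gt0//; lra.
have [t [t_range bad] t_lt] := inf_adherent h0 E_inf.
apply: bad; apply: taylor => // s /andP[s0 st].
have [st0|t0s] := ltP s t0; first by apply: level_sub; apply: lev; rewrite s0.
have -> : x + s *: d = (x + t0 *: d) + (s - t0) *: d.
  by rewrite -addrA -scalerDl subrKC.
apply: ball; rewrite enormZ ger0_norm ?subr_ge0//.
have : s - t0 < h by rewrite -/t0 in t_lt; lra.
rewrite /h ltr_pdivlMr; last by lra.
by have : 0 <= s - t0 by [lra]; nra.
Qed.

End Descent.

(** * Decrease of a step *)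

Lemma exists_expr_lt {R : realType} (q e : R) : 0 < q < 1 -> 0 < e ->
  exists j, q ^+ j < e.
Proof.
case/andP=> q0 q1 e0; have q_norm : `|q| < 1 by rewrite gtr0_norm.
have /cvgrPdist_lt /(_ _ e0)[N _ /(_ N (leqnn N))] := cvg_expr q_norm.
by rewrite /= sub0r normrN normrX gtr0_norm// => qN; exists N.
Qed.

Section NegativeCurvatureDirections.
Context {R : realType} {n : nat}.
Implicit Types (H : 'M[R]_n) (g d u v : 'cV[R]_n).

(** The length of such a step is the absolute value of the curvature along it,
    so that the quadratic term of the model is of order three in the length. *)
Definition curvature_step H g e := [/\ dot g e <= 0,
  dot e (H *m e) = - enorm e ^+ 3 & e != 0].

Lemma sgn1_mul (t : R) : 0 <= sgn1 t * t.
Proof. by rewrite /sgn1; case: ifP => [|/negbT]; rewrite -?ltNge; lra. Qed.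

Lemma sgn1_sq (t : R) : sgn1 t * sgn1 t = 1.
Proof. by rewrite /sgn1; case: ifP => _; ring. Qed.

Lemma norm_sgn1 (t : R) : `|sgn1 t| = 1.
Proof. by rewrite /sgn1; case: ifP; rewrite ?normrN normr1. Qed.

Lemma meo_direction_step H g v : enorm v = 1 -> dot v (H *m v) < 0 ->
  curvature_step H g (meo_direction H g v)
  /\ enorm (meo_direction H g v) = - dot v (H *m v).
Proof.
move=> v1 vHv; rewrite /meo_direction v1 expr1n divr1 ltr0_norm//.
set c := - dot v _; set s := sgn1 _.
have c0 : 0 < c by rewrite oppr_gt0.
have len : enorm (- (s * c) *: v) = c.
  by rewrite enormZ v1 mulr1 normrN normrM norm_sgn1 mul1r gtr0_norm.
split=> //; split.
- rewrite dotZr mulNr oppr_le0 (mulrC s) -mulrA mulr_ge0 ?(ltW c0)//.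
  by rewrite (dotC g); exact: sgn1_mul.
- have vc : dot v (H *m v) = - c by rewrite /c opprK.
  rewrite len -scalemxAr dotZl dotZr vc.
  transitivity (s * s * - c ^+ 3); first by ring.
  by rewrite sgn1_sq mul1r.
- by rewrite -enorm_gt0 len.
Qed.

Lemma cg_direction_NC H g d :
  cg_direction H g (d, NC) = meo_direction H g ((enorm d)^-1 *: d).
Proof.
rewrite /cg_direction /meo_direction.
have [->|d0] := eqVneq d 0; first by rewrite !scaler0.
have dn : 0 < enorm d by rewrite enorm_gt0.
congr (- (_ * _) *: _).
  rewrite /sgn1 dotZl; congr (if _ then _ else _).
  by rewrite pmulr_rge0// invr_gt0.
rewrite enorm_normalize// -scalemxAr !dot_linear expr1n divr1.
by rewrite !normrM ger0_norm ?invr_ge0 ?ltW//; field; rewrite gt_eqF.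
Qed.

(** Low curvature of H + 2 eps I is curvature below - eps of H. *)
Lemma low_curvature_step H g d eps : 0 < eps -> low_curvature H eps d ->
  curvature_step H g (cg_direction H g (d, NC))
  /\ eps <= enorm (cg_direction H g (d, NC)).
Proof.
move=> eps0; rewrite /low_curvature damped_mulmx dotDr dotZr enorm_sq => low.
have d0 : d != 0 by apply: contraTneq low => ->; rewrite !dot0l mulr0 mulr0 addr0 ltxx.
have dd : 0 < dot d d by rewrite dot_gt0.
have e1 := enorm_normalize d d0.
have curv : dot ((enorm d)^-1 *: d) (H *m ((enorm d)^-1 *: d)) <= - eps.
  rewrite -scalemxAr !dot_linear mulrA -expr2 exprVn enorm_sq mulrC.
  by rewrite ler_pdivrMr//; lra.
rewrite cg_direction_NC.
have [|step len] := meo_direction_step H g _ e1; first by lra.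
by split=> //; rewrite len; lra.
Qed.

End NegativeCurvatureDirections.

Section LineSearch.
Context {R : realType} {n : nat}.
Variables (prm : newton_cg_params R) (f : 'cV[R]_n -> R) (x0 : 'cV[R]_n).
Variables (U : set 'cV[R]_n) (L : R).
Hypothesis eps_H01 : 0 < eps_H prm < 1.
Hypothesis theta01 : 0 < theta prm < 1.
Hypothesis zeta01 : 0 < zeta prm < 1.
Hypothesis eta_gt0 : 0 < eta prm.
Hypothesis level_compact : compact [set x : 'cV[R]_n | f x <= f x0].
Hypothesis U_open : open U.
Hypothesis level_sub : [set x : 'cV[R]_n | f x <= f x0] `<=` U.
Hypothesis f_diff2 : twice_differentiable_on U f.
Hypothesis hess_lip : hessian_lipschitz_on U L f.
Hypothesis L_ge0 : 0 <= L.
Implicit Types (x d : 'cV[R]_n) (t T : R).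

Local Notation g := (gradient f).
Local Notation H := (hessian f).
Local Notation dec x d t := (decreases f (eta prm) x d t).

Let descent x d T : f x <= f x0 ->
  (forall t, 0 < t <= T -> model_decreases f L (eta prm) x d t) ->
  forall t, 0 < t <= T -> dec x d t.
Proof. exact: (model_decreases_decreases f x0 U). Qed.

Lemma theta_expr_range j : 0 < theta prm ^+ j <= 1.
Proof.
by case/andP: theta01 => t0 t1; rewrite exprn_gt0//= exprn_ile1// ltW.
Qed.

(** The conditions ok are the model conditions under which the first crossing
    argument ensures the decrease. All rejected trial lengths violate them,
    which bounds the accepted length from below. *)
Lemma line_searchP x d s' (ok : R -> Prop) :
  (forall t, 0 < t <= 1 -> ok t -> dec x d t) ->
  (exists j, ok (theta prm ^+ j)) -> line_search prm f x d s' ->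
  exists j, [/\ s' = Running (x + theta prm ^+ j *: d), dec x d (theta prm ^+ j)
              & forall i, (i < j)%N -> ~ ok (theta prm ^+ i)].
Proof.
move=> ok_dec [j0 ok0] [[j [dj rej ->]]|[rej _]].
  exists j; split=> // i ij oki; have /negP := rej i ij; apply.
  exact: ok_dec (theta_expr_range i) oki.
by exfalso; have /negP := rej j0; apply; exact: ok_dec (theta_expr_range j0) ok0.
Qed.

Let Leta_gt0 : 0 < L + eta prm.
Proof. by rewrite ltr_wpDl. Qed.

(** Along a curvature step the model decreases up to t = 3 / (L + eta), so the
    accepted length is 1 or at least theta times this. *)
Lemma curvature_line_search x d s' : f x <= f x0 ->
  curvature_step (H x) (g x) d -> line_search prm f x d s' ->
  exists2 x', s' = Running x' & f x' <= f x - c_nc prm L * enorm d ^+ 3.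
Proof.
move=> x_lev [gd dHd d0] ls.
have d3 : 0 < enorm d ^+ 3 by rewrite exprn_gt0 ?enorm_gt0.
have /andP[th0 th1] := theta01; have Le := Leta_gt0; have e0 := eta_gt0.
pose ok t := t * (L + eta prm) < 3.
have ok_dec t : 0 < t <= 1 -> ok t -> dec x d t.
  move=> /andP[t0 t1] okt; apply: (descent x d t x_lev) => [s /andP[s0 st]|].
    have s_ok : s * (L + eta prm) < 3.
      by apply: le_lt_trans okt; rewrite ler_wpM2r// ltW.
    rewrite /model_decreases dHd.
    have : 0 < s ^+ 2 * enorm d ^+ 3 * (3 - s * (L + eta prm)).
      by rewrite !mulr_gt0 ?exprn_gt0 ?enorm_gt0// subr_gt0.
    have : dot (g x) d * s <= 0 by rewrite mulr_le0_ge0// ltW.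
    set c := enorm d ^+ 3; lra.
  by rewrite t0 lexx.
have ok_ex : exists j, ok (theta prm ^+ j).
  have [j tj] := exists_expr_lt (theta prm) (3 / (L + eta prm)) theta01
    (divr_gt0 (ltr0n _ 3) Le).
  by exists j; rewrite /ok -ltr_pdivlMr.
have [j [-> decj rej]] := line_searchP x d s' ok ok_dec ok_ex ls.
exists (x + theta prm ^+ j *: d) => //.
have {decj} := ltW decj; move/le_trans; apply.
rewrite lerD2l lerN2 /c_nc; apply: ler_wpM2r; first exact: ltW.
rewrite ler_pM2l; last by lra.
case: j rej => [_|j rej]; first by rewrite expr0 expr1n ge_min lexx.
rewrite ge_min; apply/orP; right.
have : 3 <= theta prm ^+ j * (L + eta prm) by rewrite leNgt; apply/negP/rej.
rewrite -ler_pdivrMr// => tj.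
rewrite (_ : _ / _ = (theta prm * (3 / (L + eta prm))) ^+ 3); last first.
  by field; rewrite gt_eqF.
rewrite (exprS _ j); apply: lerXn2r; rewrite ?nnegrE.
- by rewrite mulr_ge0 ?divr_ge0// ltW.
- by rewrite mulr_ge0 ?exprn_ge0// ltW.
- by rewrite ler_pM2l.
Qed.

(** An inexact solution d of the damped Newton equation, exact in the direction
    d itself. *)
Definition newton_step x d := [/\ dot (g x) d = - dot d (damped (H x) (eps_H prm) *m d),
  eps_H prm * dot d d <= dot d (damped (H x) (eps_H prm) *m d), d != 0
  & enorm (g x + damped (H x) (eps_H prm) *m d)
      <= zeta prm / 2 * eps_H prm * enorm d].

Let newton_decreases x d t : f x <= f x0 -> newton_step x d -> 0 < t <= 1 ->
  t ^+ 2 * enorm d * (L + eta prm) < 3 * eps_H prm -> dec x d t.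
Proof.
move=> x_lev [gd curv d0 _] /andP[t0 t1] okt.
have dn : 0 < enorm d by rewrite enorm_gt0.
have Le := Leta_gt0.
have /andP[e0 _] := eps_H01.
apply: (descent x d t x_lev); last by rewrite t0 lexx.
move=> s /andP[s0 st].
have s_ok : s ^+ 2 * enorm d * (L + eta prm) < 3 * eps_H prm.
  apply: le_lt_trans okt; rewrite !ler_pM2r//.
  by apply: lerXn2r => //; rewrite nnegrE ltW.
move: curv; rewrite /model_decreases gd damped_mulmx dotDr dotZr -enorm_sq.
set q := dot d (H x *m d) => curv.
have h1 : 0 < s * enorm d ^+ 2 * (3 * eps_H prm - s ^+ 2 * enorm d * (L + eta prm)).
  by rewrite !mulr_gt0 ?exprn_gt0// subr_gt0.
have h2 : 0 <= s * (2 - s) * (q + 2 * eps_H prm * enorm d ^+ 2 - eps_H prm * enorm d ^+ 2).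
  rewrite !mulr_ge0 ?(ltW s0)// ?subr_ge0//; lra.
have h3 : 0 <= s ^+ 2 * (eps_H prm * enorm d ^+ 2).
  by rewrite !mulr_ge0 ?sqr_ge0// ltW.
have h4 : 0 <= s * (eps_H prm * enorm d ^+ 2).
  by rewrite !mulr_ge0 ?sqr_ge0// ltW.
move: h1 h2 h3 h4; set e := enorm d; set ep := eps_H prm; set et := eta prm.
lra.
Qed.

Let newton_root : R := 4 / (Num.sqrt ((4 + zeta prm) ^+ 2 + 8 * L) + 4 + zeta prm).

Let newton_rootP : L * newton_root ^+ 2 + (4 + zeta prm) * newton_root = 2.
Proof.
have /andP[z0 _] := zeta01; rewrite /newton_root.
have := L_ge0; move: (zeta prm) z0 => z z0 L0.
have D0 : 0 <= (4 + z) ^+ 2 + 8 * L by rewrite addr_ge0 ?sqr_ge0// mulr_ge0.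
have := sqr_sqrtr D0; have := sqrtr_ge0 ((4 + z) ^+ 2 + 8 * L).
set s := Num.sqrt _ => s0 s2.
have L_eq : L = (s ^+ 2 - (4 + z) ^+ 2) / 8 by lra.
by rewrite L_eq; field; rewrite gt_eqF//; lra.
Qed.

Let newton_root_gt0 : 0 < newton_root.
Proof.
have /andP[z0 _] := zeta01; rewrite divr_gt0//.
by have := sqrtr_ge0 ((4 + zeta prm) ^+ 2 + 8 * L); lra.
Qed.

(** When the unit step is short enough for the whole segment to be in the
    level set, the gradient at its end is controlled by the length of the
    step; newton_root is the positive root of the quadratic that expresses
    this control. *)
Lemma newton_unit_step x d : newton_step x d -> segment_in U x d ->
  newton_root * Num.min (enorm (g (x + d)) / eps_H prm) (eps_H prm) <= enorm d.
Proof.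
move=> [_ _ d0 res] seg.
have /andP[e0 e1] := eps_H01; have /andP[z0 _] := zeta01.
set m := Num.min _ _.
have m0 : 0 <= m by rewrite le_min divr_ge0 ?enorm_ge0 ?ltW.
have m_e : m <= eps_H prm by rewrite ge_min lexx orbT.
have m_g : m * eps_H prm <= enorm (g (x + d)).
  by rewrite -ler_pdivlMr// ge_min lexx.
have grad := taylor_gradient f U L f_diff2 hess_lip x d seg.
have g_le : enorm (g (x + d)) <= L / 2 * enorm d ^+ 2
    + (zeta prm / 2 * eps_H prm * enorm d + 2 * eps_H prm * enorm d).
  rewrite [X in enorm X](_ : _ = (g (x + d) - g x - H x *m d)
     + ((g x + damped (H x) (eps_H prm) *m d) + - ((2 * eps_H prm) *: d))).
    apply: le_trans (enormD _ _) (lerD grad _).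
    apply: le_trans (enormD _ _) (lerD res _).
    by rewrite enormN enormZ ger0_norm// mulr_ge0// ltW.
  rewrite damped_mulmx (addrA (g x)) addrK (addrC (g x)) addrA.
  by rewrite subrK subrK.
rewrite leNgt; apply/negP => short.
have dn := enorm_ge0 d.
have c0 := newton_root_gt0; have c_eq := newton_rootP; have L0 := L_ge0.
have m_gt0 : 0 < m by rewrite -(pmulr_rgt0 _ c0); exact: le_lt_trans short.
have sq_le : L * enorm d ^+ 2 <= L * (newton_root * m) ^+ 2.
  apply: ler_wpM2l => //; apply: lerXn2r; rewrite ?nnegrE//; last exact: ltW.
  by rewrite mulr_ge0// ltW.
have mm : L * newton_root ^+ 2 * m ^+ 2 <= L * newton_root ^+ 2 * (m * eps_H prm).
  apply: ler_wpM2l; first by rewrite mulr_ge0 ?sqr_ge0.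
  by rewrite expr2 ler_wpM2l.
have lin : (4 + zeta prm) * eps_H prm * enorm d
    < (4 + zeta prm) * eps_H prm * (newton_root * m).
  by rewrite ltr_pM2l// mulr_gt0//; lra.
have : (L * newton_root ^+ 2 + (4 + zeta prm) * newton_root) * (m * eps_H prm)
  = 2 * (m * eps_H prm) by rewrite c_eq.
move: m_g g_le sq_le mm lin; rewrite exprMn.
move: newton_root (eps_H prm) (zeta prm) => c e z; lra.
Qed.

(** Up to t = 1 the model decreases as long as t^2 |d| (L + eta) < 3 eps_H. If
    this holds for t = 1, newton_unit_step applies. Otherwise |d| is at least
    3 eps_H / (L + eta), and so is s^2 |d| for each rejected s <= 1; the
    accepted step, 1 or theta s, then has at least the length theta times
    3 eps_H / (L + eta). *)
Lemma newton_line_search x d s' : f x <= f x0 -> newton_step x d ->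
  line_search prm f x d s' -> exists2 x', s' = Running x' &
    f x' <= f x - c_sol prm L
      * Num.min (enorm (g x') / eps_H prm) (eps_H prm) ^+ 3.
Proof.
move=> x_lev step ls; have [_ _ d0 _] := step.
have dn : 0 < enorm d by rewrite enorm_gt0.
have /andP[e0 e1] := eps_H01; have /andP[z0 z1] := zeta01.
have /andP[th0 th1] := theta01; have Le := Leta_gt0; have et0 := eta_gt0.
pose ok t := t ^+ 2 * enorm d * (L + eta prm) < 3 * eps_H prm.
have ok_dec t : 0 < t <= 1 -> ok t -> dec x d t.
  by move=> t01; exact: newton_decreases.
have ok_ex : exists j, ok (theta prm ^+ j).
  have D0 : 0 < enorm d * (L + eta prm) by rewrite mulr_gt0.
  have [j tj] := exists_expr_lt (theta prm)
    (3 * eps_H prm / (enorm d * (L + eta prm))) theta01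
    (divr_gt0 (mulr_gt0 (ltr0n _ 3) e0) D0).
  exists j; rewrite /ok -mulrA; apply: le_lt_trans (_ : theta prm ^+ j * (enorm d * (L + eta prm)) < _); last by rewrite -ltr_pdivlMr.
  have /andP[tj0 tj1] := theta_expr_range j.
  by rewrite ler_pM2r// expr2 ler_piMl// ltW.
have [j [-> decj rej]] := line_searchP x d s' ok ok_dec ok_ex ls.
exists (x + theta prm ^+ j *: d) => //; set x' := x + _.
have /andP[tj0 tj1] := theta_expr_range j.
have decj' := ltW decj; apply: le_trans decj' _.
rewrite lerD2l lerN2 -mulrA -exprMn /c_sol -mulrA.
rewrite ler_pM2l; last by lra.
set m := Num.min (_ / _) _.
have m0 : 0 <= m by rewrite le_min divr_ge0 ?enorm_ge0 ?ltW.
have [short|long] := ltP (enorm d * (L + eta prm)) (3 * eps_H prm).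
  (* the unit step is accepted and the segment stays in the level set *)
  have ok1 t : 0 < t <= 1 -> ok t.
    case/andP => t0 t1; rewrite /ok; apply: le_lt_trans short.
    rewrite ler_pM2r// ler_piMl ?(ltW dn)//.
    by rewrite exprn_ile1// ltW.
  have j0 : j = 0%N.
    by case: j rej {decj x' m m0 tj0 tj1} => // j /(_ 0%N isT); rewrite ok1// lexx ltr01.
  have seg : segment_in U x d.
    move=> t /andP[t0 t1]; apply: level_sub => /=.
    move: t0; rewrite le_eqVlt => /predU1P[<-|t0]; first by rewrite scale0r addr0.
    have t01 : 0 < t <= 1 by rewrite t0.
    have := ok_dec t t01 (ok1 t t01); rewrite /decreases => /ltW /le_trans; apply.
    apply: le_trans x_lev; rewrite lerBlDr lerDl !mulr_ge0 ?exprn_ge0//; exact: ltW.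
  have := newton_unit_step x d step seg.
  rewrite /m /x' j0 expr0 scale1r mul1r => root_le.
  set m' := Num.min (_ / _) _ in root_le *.
  apply: le_trans (_ : newton_root ^+ 3 * m' ^+ 3 <= _).
    apply: ler_wpM2r; last by rewrite ge_min lexx.
    by rewrite exprn_ge0// le_min divr_ge0 ?enorm_ge0 ?ltW.
  rewrite -exprMn; apply: lerXn2r; rewrite ?nnegrE ?enorm_ge0//.
  by rewrite mulr_ge0 ?(ltW newton_root_gt0)// le_min divr_ge0 ?enorm_ge0 ?ltW.
set b := 3 * theta prm ^+ 2 * (1 - zeta prm) / (L + eta prm).
have b0 : 0 <= b by rewrite !mulr_ge0 ?invr_ge0 ?sqr_ge0 ?subr_ge0 ?ltW.
apply: le_trans (_ : b ^+ 3 * m ^+ 3 <= _).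
  by apply: ler_wpM2r; [rewrite exprn_ge0 | rewrite ge_min lexx orbT].
rewrite -exprMn; apply: lerXn2r; rewrite ?nnegrE.
- exact: mulr_ge0.
- by apply: mulr_ge0; exact: ltW.
apply: le_trans (_ : b * eps_H prm <= _).
  by rewrite ler_wpM2l// ge_min lexx orbT.
(* the step is at least theta times the threshold *)
apply: le_trans (_ : theta prm * (3 * eps_H prm / (L + eta prm)) <= _).
  rewrite /b (_ : _ * eps_H prm
    = theta prm * (1 - zeta prm) * (theta prm * (3 * eps_H prm / (L + eta prm)))).
    rewrite ler_piMl//; last by nra.
    by rewrite mulr_ge0 ?divr_ge0 ?mulr_ge0// ltW.
  by field; rewrite gt_eqF.
case: j rej {decj x' m m0} tj0 tj1 => [_ _ _|j rej tj0 tj1].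
  rewrite expr0 mul1r; apply: le_trans (_ : 3 * eps_H prm / (L + eta prm) <= _).
    by rewrite ler_piMl ?divr_ge0 ?mulr_ge0// ltW.
  by rewrite ler_pdivrMr.
have /andP[t0 t1] := theta_expr_range j.
rewrite exprS -(mulrA (theta prm) (_ ^+ j)) ler_pM2l// ler_pdivrMr//.
have : 3 * eps_H prm <= (theta prm ^+ j) ^+ 2 * enorm d * (L + eta prm).
  by rewrite leNgt; apply/negP/(rej j).
by move/le_trans; apply; rewrite !ler_pM2r// expr2 ler_piMl// ltW.
Qed.

End LineSearch.

(** * Counting the steps *)

Section Run.
Context {R : realType} {n : nat}.
Variables (prm : newton_cg_params R) (f : 'cV[R]_n -> R) (x0 : 'cV[R]_n).
Variables (U : set 'cV[R]_n) (L f_low : R).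
Hypothesis n_gt0 : (0 < n)%N.
Hypothesis eps_g_gt0 : 0 < eps_g prm.
Hypothesis eps_H01 : 0 < eps_H prm < 1.
Hypothesis theta01 : 0 < theta prm < 1.
Hypothesis zeta01 : 0 < zeta prm < 1.
Hypothesis eta_gt0 : 0 < eta prm.
Hypothesis hess_bound_ge0 : 0 <= odflt 0 (hess_bound prm).
Hypothesis level_compact : compact [set x : 'cV[R]_n | f x <= f x0].
Hypothesis U_open : open U.
Hypothesis level_sub : [set x : 'cV[R]_n | f x <= f x0] `<=` U.
Hypothesis f_diff2 : twice_differentiable_on U f.
Hypothesis hess_lip : hessian_lipschitz_on U L f.
Hypothesis f_lowP : forall x, f x <= f x0 -> f_low <= f x.

Local Notation g := (gradient f).
Local Notation H := (hessian f).
Local Notation critical x := (enorm (g x) <= eps_g prm).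

Let L_ge0 : 0 <= L.
Proof.
exact: (lipschitz_const_ge0 f U L x0 n_gt0 U_open (level_sub _ (lexx _)) hess_lip).
Qed.

Let Leta_gt0 : 0 < L + eta prm.
Proof. by rewrite ltr_wpDl. Qed.

Let e0 : 0 < eps_H prm. Proof. by case/andP: eps_H01. Qed.

Lemma c_sol_gt0 : 0 < c_sol prm L.
Proof.
have /andP[th0 _] := theta01; have /andP[z0 z1] := zeta01.
rewrite mulr_gt0 ?divr_gt0// lt_min !exprn_gt0//.
  by rewrite !mulr_gt0 ?exprn_gt0 ?invr_gt0 ?subr_gt0.
rewrite divr_gt0//.
by have := sqrtr_ge0 ((4 + zeta prm) ^+ 2 + 8 * L); lra.
Qed.

Lemma c_nc_gt0 : 0 < c_nc prm L.
Proof.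
have /andP[th0 _] := theta01.
by rewrite mulr_gt0 ?divr_gt0// lt_min ltr01 divr_gt0 ?mulr_gt0 ?exprn_gt0.
Qed.

Let max_term := Num.max (eps_g prm ^- 3 * eps_H prm ^+ 3) (eps_H prm ^- 3).

(** The decrease guaranteed in each step between running states that does not
    enter the region of small gradients from outside. *)
Definition step_decrease := Num.min (c_sol prm L) (c_nc prm L / 8) / max_term.

Let max_gt0 : 0 < max_term.
Proof. by rewrite lt_max invr_gt0 exprn_gt0// orbT. Qed.

Let min_gt0 : 0 < Num.min (c_sol prm L) (c_nc prm L / 8).
Proof. by rewrite lt_min c_sol_gt0 divr_gt0// c_nc_gt0. Qed.

Lemma step_decrease_gt0 : 0 < step_decrease.
Proof. exact: divr_gt0. Qed.

Let max_inv_le_H : max_term^-1 <= eps_H prm ^+ 3.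
Proof.
have H3 : 0 < eps_H prm ^+ 3 by rewrite exprn_gt0.
by rewrite -[leRHS]invrK lef_pV2 ?posrE ?invr_gt0// le_max lexx orbT.
Qed.

Let max_inv_le_g : max_term^-1 <= (eps_g prm / eps_H prm) ^+ 3.
Proof.
have H3 : 0 < eps_H prm ^+ 3 by rewrite exprn_gt0.
have G3 : 0 < eps_g prm ^+ 3 by rewrite exprn_gt0.
rewrite -[leRHS]invrK lef_pV2 ?posrE ?invr_gt0 ?exprn_gt0 ?divr_gt0//.
by rewrite -exprVn invf_div expr_div_n mulrC le_max lexx.
Qed.

Let step_decrease_nc t : eps_H prm / 2 <= t -> step_decrease <= c_nc prm L * t ^+ 3.
Proof.
move=> t_ge; apply: le_trans (_ : c_nc prm L / 8 * eps_H prm ^+ 3 <= _).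
  apply: ler_pM => //; first exact: ltW.
  - by rewrite invr_ge0 ltW.
  - by rewrite ge_min lexx orbT.
rewrite -mulrA; apply: ler_wpM2l; first exact/ltW/c_nc_gt0.
rewrite (_ : 8^-1 * _ = (eps_H prm / 2) ^+ 3); last by field.
apply: lerXn2r => //; rewrite nnegrE ?divr_ge0 ?ltW//.
by apply: lt_le_trans t_ge; rewrite divr_gt0.
Qed.

Let step_decrease_sol t : eps_g prm < t ->
  step_decrease <= c_sol prm L * Num.min (t / eps_H prm) (eps_H prm) ^+ 3.
Proof.
move=> t_gt; apply: ler_pM; first exact: ltW.
- by rewrite invr_ge0 ltW.
- by rewrite ge_min lexx.
case: (leP (t / eps_H prm)) => _ //; apply: le_trans max_inv_le_g _.
apply: lerXn2r; rewrite ?nnegrE ?divr_ge0 ?ltW//.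
  exact: lt_trans t_gt.
by rewrite ltr_pM2r// invr_gt0.
Qed.

(** A direction always exists and the line search always succeeds, so a step
    does not diverge. The decrease can only be missing when a Newton step
    enters the region of small gradients. *)
Lemma newton_cg_step_running x a d s' : f x <= f x0 ->
  (critical x -> meo_answer_valid (H x) (eps_H prm) a) ->
  newton_cg_step prm f a d (Running x) s' ->
  [/\ critical x, is_certificate a & s' = Terminated x] \/
  exists x', [/\ s' = Running x', f x' <= f x
    & critical x \/ ~~ critical x' -> f x' <= f x - step_decrease].
Proof.
move=> x_lev valid; rewrite /newton_cg_step.
have Hsym : (H x)^T = H x := hessian_sym f U L U_open f_diff2 hess_lip x L_ge0
  (level_sub _ x_lev).
have D0 := step_decrease_gt0.
have nc_step e : curvature_step (H x) (g x) e -> eps_H prm / 2 <= enorm e ->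
    line_search prm f x e s' -> exists x', [/\ s' = Running x', f x' <= f x
    & critical x \/ ~~ critical x' -> f x' <= f x - step_decrease].
  move=> step e_ge ls.
  have [x' -> dec] := curvature_line_search prm f x0 U L theta01 eta_gt0
    level_compact U_open level_sub f_diff2 hess_lip L_ge0 x e s' x_lev step ls.
  have := step_decrease_nc _ e_ge => De.
  by exists x'; split=> // [|_]; lra.
have [crit|ncrit] /= := boolP (critical x).
  have {}valid := valid crit.
  rewrite /search_direction [eps_g prm < _]ltNge crit /=.
  case: a valid => [_ ->|lambda v [lam v1 vHv]]; first by left.
  have lam0 : dot v (H x *m v) < 0 by have := e0; rewrite vHv; lra.
  have [step len] := meo_direction_step (H x) (g x) v v1 lam0.
  case=> [[-> ls]|[nodir _]]; last by case: (nodir (meo_direction (H x) (g x) v)).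
  have len_ge : eps_H prm / 2 <= enorm (meo_direction (H x) (g x) v).
    by rewrite len vHv; lra.
  right; have [x' [-> x'_le dec]] := nc_step _ step len_ge ls.
  by exists x'; split=> // _; apply: dec; left.
rewrite -ltNge in ncrit.
have gx0 : g x != 0 by rewrite -enorm_gt0; exact: lt_trans ncrit.
rewrite /search_direction ncrit.
case=> [[[[d' t] cg ->] ls]|[nodir _]]; right; last first.
  have [out cg] := capped_cg_exists (H x) (g x) (eps_H prm) (zeta prm)
    (odflt 0 (hess_bound prm)) Hsym e0 zeta01 hess_bound_ge0 gx0.
  by case: (nodir (cg_direction (H x) (g x) out)); exists out.
case: t cg ls => cg ls.
  have [step len] := low_curvature_step (H x) (g x) d' _ e0
    (capped_cg_NC _ _ _ _ _ _ cg).
  have half : eps_H prm / 2 <= eps_H prm by have := e0; lra.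
  have [x' [-> x'_le dec]] := nc_step _ step (le_trans half len) ls.
  by exists x'; split=> // -[//|nc]; apply: dec; right.
have step : newton_step prm f x d'.
  exact: capped_cg_SOL Hsym e0 zeta01 hess_bound_ge0 gx0 _ cg.
have [x' -> dec] := newton_line_search prm f x0 U L eps_H01 theta01 zeta01 eta_gt0
  level_compact U_open level_sub f_diff2 hess_lip L_ge0 x _ s' x_lev step ls.
exists x'; split=> // [|[|]].
- apply: le_trans dec _; rewrite lerBlDr lerDl mulr_ge0 ?(ltW c_sol_gt0)//.
  by rewrite exprn_ge0// le_min divr_ge0 ?enorm_ge0 ?(ltW e0).
- by [].
- by rewrite -ltNge => /step_decrease_sol; lra.
Qed.

Variables (ans : nat -> meo_answer R n) (dir : nat -> 'cV[R]_n).
Variable st : nat -> status R n.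
Hypothesis run : newton_cg_run prm f x0 ans dir st.
Hypothesis ans_valid : forall k, calls_oracle prm f (st k) ->
  valid_answer prm f (st k) (ans k).

(** A newton step into the region of small gradients need not decrease f by
    the guaranteed amount, but it is followed by a step of negative curvature
    or by termination. Hence k steps guarantee half of k decreases, where one
    decrease may be owed at a point with a small gradient. *)
Lemma run_invariant k : match st k with
  | Running x => f x <= f x0 /\
      step_decrease * (k%:R - (critical x)%:R) <= 2 * (f x0 - f x)
  | Terminated x => exists2 i, (i < k)%N &
      [/\ st i = Running x, critical x & is_certificate (ans i)]
  | Diverged => False
  end.
Proof.
have D0 := step_decrease_gt0; have [st0 steps] := run.
elim: k => [|k IH].
  rewrite st0; split=> //.
  by rewrite subrr mulr0 sub0r mulrN oppr_le0 mulr_ge0 ?ler0n// ltW.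
move: (steps k) IH (ans_valid k); rewrite /calls_oracle /valid_answer.
case Ek: (st k) => [x|x|] //= step; last first.
  by move=> [i ik tm] _; rewrite step; exists i; rewrite 1?ltnW.
move=> [x_lev bound] valid.
have [[crit cert ->]|[x' [-> x'_le dec]]] :=
  newton_cg_step_running x _ _ _ x_lev valid step.
  by exists k.
split; first exact: le_trans x_lev.
rewrite -natr1.
have [cx'|cx'] := boolP (critical x').
  have [cx|cx] := boolP (critical x); last first.
    by move: bound; rewrite (negPf cx) /= subr0 addrK; lra.
  have := dec (or_introl cx); move: bound; rewrite cx /=; lra.
have := dec (or_intror cx'); move: bound.
by case: (critical x); rewrite /= ?subr0; lra.
Qed.

(** With X decreases available above f_low, the invariant allows at most
    2 X + 1 steps, and K2bar is at least 3 X + 2. *)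
Lemma run_terminates : exists x, st (K2bar prm f L f_low x0) = Terminated x.
Proof.
set K := K2bar _ _ _ _ _.
have := run_invariant K; case: (st K) => [x|x _|//]; last by exists x.
case=> x_lev bound; exfalso.
have D0 := step_decrease_gt0; have := f_lowP x x_lev => low.
have crit_le : (critical x)%:R <= 1 :> R by case: (critical x); rewrite ?ler01.
have : step_decrease * (K%:R - 1) <= 2 * (f x0 - f_low).
  have : step_decrease * (K%:R - 1) <= step_decrease * (K%:R - (critical x)%:R).
    by rewrite ler_pM2l//; lra.
  lra.
have : 3 * (f x0 - f_low) / step_decrease + 2 <= K%:R.
  rewrite /K /K2bar natrD lerD2r.
  have -> : 3 * (f x0 - f_low) / step_decrease
      = 3 * (f x0 - f_low) / Num.min (c_sol prm L) (c_nc prm L / 8) * max_term.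
    by rewrite /step_decrease invf_div mulrA mulrAC.
  apply: le_trans (ceil_ge _) _.
  by rewrite natr_absz ler_int ler_norm.
rewrite -lerBrDr ler_pdivrMr//.
have : 0 <= f x0 - f_low by rewrite subr_ge0 f_lowP.
nra.
Qed.

Lemma run_certified i k x : st i = Running x -> critical x ->
  is_certificate (ans i) -> (i < k)%N -> st k = Terminated x.
Proof.
move=> sti crit cert; have [_ steps] := run.
elim: k => // k IH; rewrite ltnS leq_eqVlt => /predU1P[<-|/IH stk].
  by have := steps i; rewrite sti /= crit cert.
by have := steps k; rewrite stk.
Qed.

End Run.

(** * Probability of a wrong certificate *)

Lemma sigma_algebra_setD {T : pointedType} (G : set (set T)) A A' :
  sigma_algebra setT G -> G A -> G A' -> G (A `\` A').
Proof.
move=> sG GA GA'; rewrite -(sigma_algebra_id sG).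
by apply: (@measurableD _ (g_sigma_algebraType G)); exact: sub_sigma_algebra.
Qed.

Section SuccessiveFailures.
Context {R : realType} {disp : measure_display} {Omega : measurableType disp}.
Variables (P : probability Omega R) (F : nat -> set (set Omega)).
Variables (B : nat -> set Omega) (delta : R).
Hypothesis F_filtration : filtration F.
Hypothesis delta_le1 : delta <= 1.
Hypothesis F_B : forall k, F k.+1 (B k).
Hypothesis P_B : forall k A, F k A -> ((1 - delta)%:E * P A <= P (A `\` B k))%E.

Let no_failure K := ~` \bigcup_(k < K) B k.

Let no_failureS K : no_failure K.+1 = no_failure K `\` B K.
Proof.
apply/seteqP; split=> w.
  move=> nf; split=> [[k /= kK Bk]|BK]; apply: nf.
    by exists k => //=; exact: ltnW.
  by exists K => /=.
move=> [nf nBK] [k /=]; rewrite ltnS leq_eqVlt => /predU1P[->//|kK] Bk.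
by apply: nf; exists k.
Qed.

Let F_no_failure K : F K (no_failure K).
Proof.
have [Fs _ FS] := F_filtration.
elim: K => [|K IH].
  have [F0 FC _] := Fs 0%N.
  rewrite /no_failure bigcup_mkord big_ord0 -setTD; exact: FC.
by rewrite no_failureS; apply: sigma_algebra_setD => //; exact: FS.
Qed.

(** The event of no failure before K belongs to F K, so the conditional bound
    of the failure at K applies to it and contributes a factor 1 - delta. *)
Lemma no_failure_probability K : (((1 - delta) ^+ K)%:E <= P (~` \bigcup_(k < K) B k))%E.
Proof.
rewrite -/(no_failure K); elim: K => [|K IH].
  by rewrite /no_failure bigcup_mkord big_ord0 setC0 probability_setT expr0.
rewrite no_failureS exprS EFinM.
apply: le_trans (P_B _ _ (F_no_failure K)).
by apply: lee_wpmul2l => //; rewrite lee_fin subr_ge0.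
Qed.

End SuccessiveFailures.

Section OracleFailures.
Context {R : realType} {n : nat} {disp : measure_display}.
Context {Omega : measurableType disp}.
Variables (prm : newton_cg_params R) (f : 'cV[R]_n -> R).
Variables (P : probability Omega R) (F : nat -> set (set Omega)) (C delta : R).
Variables (ans : nat -> Omega -> meo_answer R n) (nprod : nat -> Omega -> nat).
Variable st : nat -> Omega -> status R n.
Hypothesis delta01 : 0 <= delta < 1.
Hypothesis F_filtration : filtration F.
Hypothesis run_adapted : adapted prm f ans nprod st F.
Hypothesis ans_valid : forall k w, oracle_called prm f st k w ->
  valid_answer prm f (st k w) (ans k w).
Hypothesis ans_reliable : oracle_reliable prm f ans nprod st P F C delta.

Local Notation called k := (oracle_called prm f st k).

Definition wrong_certificate k :=
  (called k `&` [set w | is_certificate (ans k w)])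
    `\` (called k `&` [set w | hessian_above prm f (st k w)]).

Lemma wrong_certificate_observable k : F k.+1 (wrong_certificate k).
Proof.
have [Fs _ FS] := F_filtration; have [_ above cert _] := run_adapted k.
by apply: sigma_algebra_setD => //; exact: FS.
Qed.

Lemma wrong_certificate_called k : wrong_certificate k `<=` called k.
Proof. by move=> w [[]]. Qed.

Let cheap k := called k `&` [set w | (nprod k w)%:Z <= N_meo n prm C].

Let cheap_measurable k : measurable (cheap k).
Proof.
have [_ Fm _] := F_filtration; have [_ _ _ prods] := run_adapted k.
have -> : cheap k = \bigcup_(m in [set m : nat | m%:Z <= N_meo n prm C])
    (called k `&` [set w | nprod k w = m]).
  apply/seteqP; split=> [w [cw le]|w [m /= le [cw E]]]; last by split=> //=; rewrite E.
  by exists (nprod k w).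
by apply: bigcup_measurable => m _; exact/(Fm k.+1).
Qed.

(** On a call with a valid answer, success means that the number of products
    is within the bound and that a certificate, if any, is right. *)
Let success_eq k : called k `&`
    [set w | oracle_success prm f C (st k w) (ans k w) (nprod k w)]
  = cheap k `\` wrong_certificate k.
Proof.
apply/seteqP; split=> w.
  move=> [cw]; rewrite /oracle_success /=; case E: (st k w) => [x|x|] //= [ok le].
  split; first by split.
  move=> [[_ /= cert]]; apply; split=> //; rewrite /hessian_above /= E /=.
  by case: (ans k w) ok cert.
move=> [[cw le] nw]; split=> //.
have := ans_valid k w cw; have := cw.
rewrite /oracle_success /oracle_called /calls_oracle /valid_answer /=.
case E: (st k w) => [x|x|] //= _ valid; split=> //.
case Ea: (ans k w) valid => [|lambda v] /= valid.
  apply: contrapT => bad; apply: nw; split; first by split=> //=; rewrite Ea.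
  by move=> [_]; rewrite /hessian_above /= E.
by have [lam _ ->] := valid.
Qed.

(** Where the oracle is not called nothing can go wrong, and where it is called
    a success excludes a wrong certificate. *)
Lemma wrong_certificate_probability k A : F k A ->
  ((1 - delta)%:E * P A <= P (A `\` wrong_certificate k))%E.
Proof.
move=> FA; have [_ Fm _] := F_filtration; have [Fc _ _ _] := run_adapted k.
have mA : measurable A by exact: (Fm k).
have mc : measurable (called k) by exact: (Fm k).
have mB : measurable (wrong_certificate k).
  by apply: (Fm k.+1); exact: wrong_certificate_observable.
have d0 : (0 <= (1 - delta)%:E :> \bar R)%E.
  by rewrite lee_fin subr_ge0; case/andP: delta01 => _ /ltW.
have d1 : ((1 - delta)%:E <= 1%:E :> \bar R)%E.
  by rewrite lee_fin gerBl; case/andP: delta01.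
rewrite (measureDI P mA mc) (measureDI P (measurableD mA mB) mc).
rewrite ge0_muleDr ?measure_ge0//; apply: leeD.
  rewrite setDDl (setUidr (@wrong_certificate_called k)).
  rewrite -[leRHS]mul1e; apply: lee_wpmul2r => //; exact: measure_ge0.
apply: le_trans (ans_reliable k A FA) _.
rewrite -setIA success_eq; apply: le_measure.
- by rewrite inE; apply: measurableI => //; exact: measurableD.
- by rewrite inE; apply: measurableI => //; exact: measurableD.
- by move=> w [Aw [[cw _] nw]].
Qed.

End OracleFailures.

Theorem theorem4 (R : realType) (n : nat) (n_gt0 : (0 < n)%N)
  (f : 'cV[R]_n -> R) (x0 : 'cV[R]_n)
  (prm : newton_cg_params R)
  (eps_g_gt0 : 0 < eps_g prm) (eps_H01 : 0 < eps_H prm < 1)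
  (theta01 : 0 < theta prm < 1) (zeta01 : 0 < zeta prm < 1)
  (eta_gt0 : 0 < eta prm)
  (hess_boundP : forall M, hess_bound prm = Some M ->
     0 < M /\ forall x, f x <= f x0 -> opnorm (hessian f x) <= M)
  (level_compact : compact [set x : 'cV[R]_n | f x <= f x0])
  (U : set 'cV[R]_n) (L_H f_low : R)
  (U_open : open U)
  (level_sub : [set x : 'cV[R]_n | f x <= f x0] `<=` U)
  (f_diff2 : twice_differentiable_on U f)
  (hess_lip : hessian_lipschitz_on U L_H f)
  (f_lowP : forall x, f x <= f x0 -> f_low <= f x)
  (delta : R) (delta01 : 0 <= delta < 1)
  (C_meo : R -> R -> R) (C_meo_log : at_most_logarithmic C_meo)
  (disp : measure_display) (Omega : measurableType disp)
  (P : probability Omega R)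
  (F : nat -> set (set Omega)) (F_filtration : filtration F)
  (ans : nat -> Omega -> meo_answer R n) (nprod : nat -> Omega -> nat)
  (dir : nat -> Omega -> 'cV[R]_n) (st : nat -> Omega -> status R n)
  (run : forall w, newton_cg_run prm f x0 (ans ^~ w) (dir ^~ w) (st ^~ w))
  (trial_sub : forall w,
     run_trial_points prm f (ans ^~ w) (dir ^~ w) (st ^~ w) `<=` U)
  (run_adapted : adapted prm f ans nprod st F)
  (ans_valid : forall k w, oracle_called prm f st k w ->
     valid_answer prm f (st k w) (ans k w))
  (ans_reliable : oracle_reliable prm f ans nprod st P F
     (C_meo delta (eps_H prm)) delta) :
  let K := K2bar prm f L_H f_low x0 in
  let correct := [set w | terminated_at
    (fun x => enorm (gradient f x) <= eps_g prm
              /\ - eps_H prm <= lambda_min (hessian f x)) (st K w)] in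
  let incorrect := [set w | terminated_at
    (fun x => enorm (gradient f x) <= eps_g prm
              /\ lambda_min (hessian f x) < - eps_H prm) (st K w)] in
  [/\ measurable correct, (((1 - delta) ^+ K)%:E <= P correct)%E,
      measurable incorrect
    & (P incorrect <= (1 - (1 - delta) ^+ K)%:E)%E].
Proof.
move=> K correct incorrect.
have hess_bound_ge0 : 0 <= odflt 0 (hess_bound prm).
  by case E: (hess_bound prm) => [M|] //=; have [/ltW] := hess_boundP M E.
pose wrong := wrong_certificate prm f ans st.
have terminated w : exists x, st K w = Terminated x.
  exact: (run_terminates prm f x0 U L_H f_low n_gt0 eps_g_gt0 eps_H01 theta01 zeta01
    eta_gt0 hess_bound_ge0 level_compact U_open level_sub f_diff2 hess_lip f_lowP
    _ _ _ (run w) (fun k => ans_valid k w)).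
have invariant w := run_invariant prm f x0 U L_H n_gt0 eps_g_gt0 eps_H01 theta01
  zeta01 eta_gt0 hess_bound_ge0 level_compact U_open level_sub f_diff2 hess_lip
  _ _ _ (run w) (fun k => ans_valid k w) K.
have incorrectE : incorrect = \bigcup_(k < K) wrong k.
  apply/seteqP; split=> w.
    rewrite /incorrect /=; have := invariant w.
    case: (st K w) => //= x [i iK [sti crit cert]] [_ low].
    exists i => //; split.
      by split=> //; rewrite /oracle_called /calls_oracle /= sti.
    by move=> [_]; rewrite /hessian_above /= sti /= leNgt low.
  move=> [i /= iK [[]]]; rewrite /oracle_called /calls_oracle /=.
  case E: (st i w) => [x|//|//] /= crit cert not_above.
  rewrite /incorrect /= (run_certified prm f x0 _ _ _ (run w) i K x E crit cert iK).
  split=> //; rewrite ltNge; apply/negP => above; apply: not_above.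
  by split.
have correctE : correct = ~` \bigcup_(k < K) wrong k.
  rewrite -incorrectE; apply/seteqP; split=> w; rewrite /correct /incorrect /=.
    by have [x ->] := terminated w => /= -[_ above] [_]; rewrite ltNge above.
  have [x stK] := terminated w; have := invariant w.
  rewrite stK /= => -[_ _ [_ crit _]] ok; split=> //.
  by rewrite leNgt; apply/negP => low; exact: ok.
have [_ Fm _] := F_filtration.
have m_wrong k : measurable (wrong k).
  exact/(Fm k.+1)/(wrong_certificate_observable _ _ _ _ _ _ F_filtration run_adapted).
have m_incorrect : measurable incorrect.
  by rewrite incorrectE; apply: bigcup_measurable => k _.
have m_correct : measurable correct.
  by rewrite correctE -incorrectE; exact: measurableC.
have P_correct : (((1 - delta) ^+ K)%:E <= P correct)%E.
  rewrite correctE; apply: (no_failure_probability P F) => // [|k|k A FA].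
  - by case/andP: delta01 => _ /ltW.
  - exact: (wrong_certificate_observable _ _ _ _ _ _ F_filtration run_adapted).
  - exact: (wrong_certificate_probability prm f P F (C_meo delta (eps_H prm)) delta).
split=> //.
have -> : incorrect = ~` correct by rewrite correctE setCK.
by rewrite probability_setC// EFinB; exact: leeB.
Qed.
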